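(* The following is provable in $\mathrm{BZFC}$: for all cardinal numbers $\kappa$ and $\mu$, $$\kappa+\mu=(\kappa_{\mathbf t}+\mu_{\mathbf t})+(\kappa_{\mathbf b}+\mu_{\mathbf b})\cdot\mathfrak b+(\kappa_{\mathbf n}+\mu_{\mathbf n})\cdot\mathfrak n$$ and $$\kappa\cdot\mu=\kappa_{\mathbf t}\mu_{\mathbf t}+(\kappa_{\mathbf t}\mu_{\mathbf b}+\kappa_{\mathbf b}\mu_{\mathbf t}+\kappa_{\mathbf b}\mu_{\mathbf b})\cdot\mathfrak b+(\kappa_{\mathbf t}\mu_{\mathbf n}+\kappa_{\mathbf n}\mu_{\mathbf t}+\kappa_{\mathbf n}\mu_{\mathbf n})\cdot\mathfrak n.$$ Moreover, $\kappa\cdot 1=\kappa$, $\kappa\cdot 0=0$, $\mathfrak b^2=\mathfrak b$, $\mathfrak n^2=\mathfrak n$, and $\mathfrak b\cdot\mathfrak n=0$.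
   Context: Logic. The background logic is the four-valued first-order logic BS4 with primitives $\sim,\land,\lor,\rightarrow,\leftrightarrow,\bot,\forall,\exists$. A model has a non-empty domain $M$, the usual interpretations of constants and function symbols, and, for each $n$-ary relation symbol $R$, two independent interpretations $R^+,R^-\subseteq M^n$; $=^+$ is true identity and $=^-$ is a symmetric relation. Truth and falsity are defined simultaneously (a formula may be true, false, both, or neither): an atomic formula is true/false according to $R^+$/$R^-$; $\sim\varphi$ is true iff $\varphi$ is false, and false iff $\varphi$ is true; $\varphi\land\psi$ is true iff both are true, false iff at least one is false; $\lor$ dually; $\varphi\rightarrow\psi$ is true iff ($\varphi$ true implies $\psi$ true), false iff $\varphi$ is true and $\psi$ is false; $\varphi\leftrightarrow\psi$ is true iff ($\varphi$ true iff $\psi$ true), false iff ($\varphi$ true and $\psi$ false) or ($\varphi$ false and $\psi$ true); $\forall$ is true iff all instances are true, false iff some instance is false; $\exists$ is true iff some instance is true, false iff all instances are false; $\bot$ is false and not true. $\Gamma\vDash\varphi$ iff $\varphi$ is true in every model in which all of $\Gamma$ is true. Asserting a formula means asserting that it is true; English ''iff'', ''if/then'', ''and'', ''or'' between formulas concern truth. Abbreviations: $\neg\varphi:=\varphi\rightarrow\bot$ (true iff $\varphi$ is not true); $!\varphi:=\sim\neg\varphi$ (two-valued, true iff $\varphi$ is true); $?\varphi:=\neg\sim\varphi$ (two-valued, true iff $\varphi$ is not false); $\circ\varphi:=\,!\varphi\leftrightarrow ?\varphi$; $\varphi\Rightarrow\psi:=(\varphi\rightarrow\psi)\land(\sim\psi\rightarrow\sim\varphi)$;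 $\varphi\Leftrightarrow\psi:=(\varphi\leftrightarrow\psi)\land(\sim\varphi\leftrightarrow\sim\psi)$; $\varphi\,\&\,\psi:=\,\sim(\varphi\rightarrow\sim\psi)$; $\exists x\in A\,\varphi:=\exists x(x\in A\,\&\,\varphi)$; $\forall x\in A\,\varphi:=\forall x(x\in A\rightarrow\varphi)$. A slashed relation symbol is the $\sim$-negation of the relation. Set theory. $\mathrm{BZFC}$ is a BS4-theory in the language $\{\in,=\}$ whose objects are called sets. It includes: Extensionality $\forall A\forall B(A=B\Leftrightarrow\forall x(x\in A\Leftrightarrow x\in B))$; Comprehension $\forall A\exists B\forall x(x\in B\Leftrightarrow x\in A\land\varphi(x))$; ACLA: $\exists A(A^!\not\subseteq A^?)\land\exists A(A^?\not\subseteq A^!)$; Choice: every classical set of non-empty sets has a choice function. Here $A=\{x:\varphi(x)\}$ means $\forall x(x\in A\Leftrightarrow\varphi(x))$; $A\subseteq B:=\forall x(x\in A\Rightarrow x\in B)$; $A$ is classical if $\forall x\,{\circ}(x\in A)$; $A^!:=\{x:{!}(x\in A)\}$ and $A^?:=\{x:{?}(x\in A)\}$. The remaining axioms are suitable analogues of those of $\mathrm{ZFC}$; available consequences are: $A^!,A^?$ are (classical) sets; $A\subseteq B\leftrightarrow(A^!\subseteq B^!\land A^?\subseteq B^?)$, $A\not\subseteq B\leftrightarrow A^!\not\subseteq B^?$, $A=B\leftrightarrow(A^!=B^!\land A^?=B^?)$, $A\neq B\leftrightarrow(A^!\not\subseteq B^?\lor B^!\not\subseteq A^?)$; for all classical sets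 $X,Y$ there is a unique set $\langle X|Y\rangle$ with $\langle X|Y\rangle^!=X$, $\langle X|Y\rangle^?=Y$; ordered pairs (and triples) are encoded so that $(a,b)=(c,d)\Leftrightarrow(a=c\land b=d)$; usual $\mathrm{ZFC}$ set theory (including choice and von Neumann ordinals, which live in the inner $\mathrm{ZFC}$-model of hereditarily classical sets) applies to classical sets, whose elements may be arbitrary sets. For a classical set $X$, $|X|_{Cl}$ is the least von Neumann ordinal in bijection with $X$. Put $A_{\mathbf b}:=A^!\setminus A^?$, $A_{\mathbf t}:=A^!\cap A^?$, $A_{\mathbf n}:=A^?\setminus A^!$, $\mathrm{rlm}(A):=A^!\cup A^?$ (all classical sets). For pairwise disjoint classical $X,Y,Z$, $\langle X|Y|Z\rangle$ is the unique set $A$ with $A_{\mathbf b}=X$, $A_{\mathbf t}=Y$, $A_{\mathbf n}=Z$. $\emptyset=\{x:\bot\}$, and $\{a\}$ is the classical set $\{x:{!}(x=a)\}$. Cardinal numbers. The cardinal number of $A$ is the triple $|A|:=(X,Y,Z)$ with $$X:=\big\langle |A^!|_{Cl}\,\big|\,|A^?|_{Cl}\big\rangle,\quad Y:=\big\langle |A_{\mathbf t}|_{Cl}\,\big|\,|A^?|_{Cl}\big\rangle,\quad Z:=\big\langle |A_{\mathbf b}|_{Cl}\,\big|\,|A_{\mathbf n}|_{Cl}\big\rangle.$$ Cardinal numbers are the elements of $\{|x|:x\text{ a set}\}$. A classical cardinal is a cardinal number of the form $|X|$ with $X$ a classical set. Arithmetic: $|A|+|B|:=|A\uplus B|$ and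 $|A|\cdot|B|:=|A\times B|$, where $A\times B:=\{(x,y):x\in A\land y\in B\}$ (so $(a,b)\in A\times B\Leftrightarrow a\in A\land b\in B$) and $A\uplus B:=\{(x,0):x\in A\}\cup\{(x,1):x\in B\}$ (so $(a,0)\in A\uplus B\Leftrightarrow a\in A$ and $(b,1)\in A\uplus B\Leftrightarrow b\in B$). Constants: $0:=|\emptyset|$, $1:=|\{\emptyset\}|$, $\mathfrak b:=|\langle\{\emptyset\}|\emptyset|\emptyset\rangle|$, $\mathfrak n:=|\langle\emptyset|\emptyset|\{\emptyset\}\rangle|$. For each cardinal number $\kappa$, $\kappa_{\mathbf t},\kappa_{\mathbf b},\kappa_{\mathbf n}$ denote the uniquely determined classical cardinals with $\kappa=\kappa_{\mathbf t}+\kappa_{\mathbf b}\cdot\mathfrak b+\kappa_{\mathbf n}\cdot\mathfrak n$; if $\kappa=|A|$ these are $|A_{\mathbf t}|,|A_{\mathbf b}|,|A_{\mathbf n}|$. *)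

(* Defs.v *)
From Stdlib Require Import Classical.

Set Implicit Arguments.
Unset Strict Implicit.
Unset Printing Implicit Defensive.

(** A four-valued proposition: its truth and its falsity are independent. *)
Record fval : Type := FV { tr : Prop; fa : Prop }.

Definition Not (p : fval) := FV (fa p) (tr p).
Definition And (p q : fval) := FV (tr p /\ tr q) (fa p \/ fa q).
Definition Or (p q : fval) := FV (tr p \/ tr q) (fa p /\ fa q).
Definition To (p q : fval) := FV (tr p -> tr q) (tr p /\ fa q).
Definition Equiv (p q : fval) :=
  FV (tr p <-> tr q) ((tr p /\ fa q) \/ (fa p /\ tr q)).
Definition Bot := FV False True.
Definition All (T : Type) (P : T -> fval) :=
  FV (forall x, tr (P x)) (exists x, fa (P x)).
Definition Ex (T : Type) (P : T -> fval) :=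
  FV (exists x, tr (P x)) (forall x, fa (P x)).

Declare Scope bs4_scope.
Delimit Scope bs4_scope with bs4.
Bind Scope bs4_scope with fval.

Notation "∼ p" := (Not p) (at level 75, right associativity) : bs4_scope.
Notation "p ∧ q" := (And p q) (at level 80, right associativity) : bs4_scope.
Notation "p ∨ q" := (Or p q) (at level 85, right associativity) : bs4_scope.
Notation "p → q" := (To p q)
  (at level 99, q at level 200, right associativity) : bs4_scope.
Notation "p ↔ q" := (Equiv p q) (at level 95, no associativity) : bs4_scope.
Notation "∀ x .. y , p" := (All (fun x => .. (All (fun y => p)) ..))
  (at level 200, x binder, y binder, right associativity) : bs4_scope.
Notation "∃ x .. y , p" := (Ex (fun x => .. (Ex (fun y => p)) ..))
  (at level 200, x binder, y binder, right associativity) : bs4_scope.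

Local Open Scope bs4_scope.

Definition Neg (p : fval) := p → Bot.
Notation "¬ p" := (Neg p) (at level 75, right associativity) : bs4_scope.

(** Written [!p], [?p], [∘p] and (for [Amp]) [p & q] in the literature. *)
Definition Bang (p : fval) := ∼ ¬ p.
Definition Quest (p : fval) := ¬ ∼ p.
Definition Circ (p : fval) := Bang p ↔ Quest p.

Definition SImp (p q : fval) := (p → q) ∧ (∼ q → ∼ p).
Notation "p ⇒ q" := (SImp p q) (at level 95, no associativity) : bs4_scope.
Definition SIff (p q : fval) := (p ↔ q) ∧ (∼ p ↔ ∼ q).
Notation "p ⇔ q" := (SIff p q) (at level 95, no associativity) : bs4_scope.

Definition Amp (p q : fval) := ∼ (p → ∼ q).

Record model : Type := Model {
  dom :> Type;
  dom_inhabited : inhabited dom;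
  mem_pos : dom -> dom -> Prop;
  mem_neg : dom -> dom -> Prop;
  eq_neg : dom -> dom -> Prop;
  eq_neg_sym : forall x y, eq_neg x y -> eq_neg y x
}.

Definition Mem (M : model) (x y : M) := FV (mem_pos x y) (mem_neg x y).
Definition Eql (M : model) (x y : M) := FV (x = y) (eq_neg x y).
Notation "x ∈ y" := (Mem x y) (at level 70, no associativity) : bs4_scope.
Notation "x == y" := (Eql x y) (at level 70, no associativity) : bs4_scope.

(** Sentences are written directly through their four-valued interpretation in
    a model.  Only first-order quantification over the domain is used, so that
    they are the interpretations of BS4-sentences. *)
Definition sentence := forall M : model, fval.
Definition theory := sentence -> Prop.

Definition entails (T : theory) (p : sentence) : Prop :=
  forall M : model, (forall q, T q -> tr (q M)) -> tr (p M).
Notation "T ⊨ p" := (entails T p) (at level 90, no associativity) : type_scope.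

(** Syntactic formulas, over which the axiom schemata range.  Variables are de
    Bruijn indices; those not bound in the formula are parameters. *)
Inductive form : Type :=
| fMem (i j : nat)
| fEql (i j : nat)
| fBot
| fNot (f : form)
| fAnd (f g : form)
| fOr (f g : form)
| fTo (f g : form)
| fEquiv (f g : form)
| fAll (f : form)
| fEx (f : form).

Definition scons (T : Type) (x : T) (e : nat -> T) : nat -> T :=
  fun n => match n with O => x | S m => e m end.

Fixpoint eval (M : model) (f : form) (e : nat -> M) : fval :=
  match f with
  | fMem i j => e i ∈ e j
  | fEql i j => e i == e j
  | fBot => Bot
  | fNot f => ∼ eval f e
  | fAnd f g => eval f e ∧ eval g e
  | fOr f g => eval f e ∨ eval g e
  | fTo f g => eval f e → eval g e
  | fEquiv f g => eval f e ↔ eval g e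
  | fAll f => ∀ x, eval f (scons x e)
  | fEx f => ∃ x, eval f (scons x e)
  end.

(** The value [X : class M] stands for the class term [{x : X x}].  A defined
    term is represented by the formula "[x] is the value of the term". *)

Definition class (M : model) := M -> fval.

Definition AllIn (M : model) (A : M) (P : M -> fval) := ∀ x, x ∈ A → P x.
Definition ExIn (M : model) (A : M) (P : M -> fval) := ∃ x, Amp (x ∈ A) (P x).
Notation "∀[ x ∈ A ] p" := (AllIn A (fun x => p))
  (at level 200, x name, A at level 69, right associativity) : bs4_scope.
Notation "∃[ x ∈ A ] p" := (ExIn A (fun x => p))
  (at level 200, x name, A at level 69, right associativity) : bs4_scope.

Definition IsSet (M : model) (A : M) (X : class M) := ∀ x, x ∈ A ⇔ X x.
Notation "A ≐ X" := (IsSet A X) (at level 70, no associativity) : bs4_scope.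

Section Vocabulary.
Variable M : model.
Implicit Types (A B C X Y Z a b e f k o p x y z : M).

Definition ext A : class M := fun x => x ∈ A.
Definition Sub (X Y : class M) := ∀ x, X x ⇒ Y x.
Definition Classical A := ∀ x, Circ (x ∈ A).

Definition empty : class M := fun _ => Bot.
(** [{a}] and [{a,b}] are classical sets. *)
Definition sing a : class M := fun x => Bang (x == a).
Definition upair a b : class M := fun x => Bang (x == a) ∨ Bang (x == b).

(** [A^!], [A^?], and the parts [A_b], [A_t], [A_n]. *)
Definition inn A : class M := fun x => Bang (x ∈ A).
Definition out A : class M := fun x => Quest (x ∈ A).
Definition part_b A : class M := fun x => inn A x ∧ ∼ out A x.
Definition part_t A : class M := fun x => inn A x ∧ out A x.
Definition part_n A : class M := fun x => out A x ∧ ∼ inn A x.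

(** [A = <X|Y>] and [A = <X|Y|Z>]. *)
Definition Bracket2 A (X Y : class M) :=
  (∀ x, inn A x ⇔ X x) ∧ (∀ x, out A x ⇔ Y x).
Definition Bracket3 A (X Y Z : class M) :=
  (∀ x, part_b A x ⇔ X x) ∧ (∀ x, part_t A x ⇔ Y x) ∧
  (∀ x, part_n A x ⇔ Z x).

(** Ordered pairs.  A classical Kuratowski pair would violate the falsity half
    of [(a,b) = (c,d) ⇔ (a = c ∧ b = d)], because [{a} = {c}] is two-valued.
    We put [(a,b) := { {0,{x}} : x ∈ a } ∪ { {{x}} : x ∈ b }], so that
    membership in [a] and in [b] is reflected by membership in the pair; see
    [pair_law] below. *)
Definition Tag1 z x := ∃ e s, e ≐ empty ∧ s ≐ sing x ∧ z ≐ upair e s.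
Definition Tag2 z x := ∃ s, s ≐ sing x ∧ z ≐ sing s.
Definition Pair p a b :=
  p ≐ (fun z => (∃ x, Bang (Tag1 z x) ∧ x ∈ a) ∨
                (∃ x, Bang (Tag2 z x) ∧ x ∈ b)).
Definition Triple p a b c := ∃ q, Pair q a b ∧ Pair p q c.

(** [f] is a classical set of pairs, and [App f x y] says [(x,y) ∈ f]. *)
Definition App f x y := ∃ p, Pair p x y ∧ p ∈ f.
Definition Function f A :=
  Classical f ∧ (∀[p ∈ f] ∃[x ∈ A] ∃ y, Pair p x y) ∧
  (∀[x ∈ A] ∃ y, App f x y ∧ (∀ z, App f x z → z == y)).
Definition Bijection f A B :=
  Function f A ∧ (∀ x y, App f x y → y ∈ B) ∧
  (∀[y ∈ B] ∃ x, App f x y ∧ (∀ z, App f z y → z == x)).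
Definition Equipotent A B := ∃ f, Bijection f A B.

(** Von Neumann ordinals: transitive hereditarily classical sets that are
    well-ordered by membership. *)
Definition Ordinal o :=
  Classical o ∧
  (∀[x ∈ o] Classical x) ∧
  (∀[x ∈ o] ∀[y ∈ x] y ∈ o) ∧
  (∀[x ∈ o] ¬ (x ∈ x)) ∧
  (∀[x ∈ o] ∀[y ∈ o] ∀[z ∈ o] (x ∈ y → y ∈ z → x ∈ z)) ∧
  (∀[x ∈ o] ∀[y ∈ o] (x ∈ y ∨ x == y ∨ y ∈ x)) ∧
  (∀ A, Classical A ∧ Sub (ext A) (ext o) ∧ (∃ x, x ∈ A) →
        ∃[x ∈ A] ∀[y ∈ A] ¬ (y ∈ x)).

(** [o] is [|X|_Cl], for a classical set [X] given by a class term. *)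
Definition ClCard (X : class M) o :=
  ∃ A, A ≐ X ∧ Ordinal o ∧ Equipotent A o ∧
       (∀ o', Ordinal o' ∧ Equipotent A o' → o == o' ∨ o ∈ o').

(** [k = |A|]. *)
Definition Card A k :=
  ∃ i q t b n X Y Z,
    ClCard (inn A) i ∧ ClCard (out A) q ∧
    ClCard (part_t A) t ∧ ClCard (part_b A) b ∧ ClCard (part_n A) n ∧
    Bracket2 X (ext i) (ext q) ∧ Bracket2 Y (ext t) (ext q) ∧
    Bracket2 Z (ext b) (ext n) ∧
    Triple k X Y Z.

Definition CardinalNumber k := ∃ A, Card A k.
Definition ClassicalCardinal k := ∃ A, Classical A ∧ Card A k.

(** [A × B] and [A ⊎ B]; the tags of the latter are the ordinals 0 and 1. *)
Definition Zero e := e ≐ empty.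
Definition One e := ∃ z, Zero z ∧ e ≐ sing z.
Definition prod A B : class M :=
  fun z => ∃ x y, Bang (Pair z x y) ∧ (x ∈ A ∧ y ∈ B).
Definition dsum A B : class M :=
  fun z => (∃ x, Bang (∃ e, Zero e ∧ Pair z x e) ∧ x ∈ A) ∨
           (∃ x, Bang (∃ e, One e ∧ Pair z x e) ∧ x ∈ B).

(** A descriptive term, represented by the formula "[v] is its value". *)
Definition term := M -> fval.
Implicit Types s t : term.

(** Equality of two terms, in the sense of Russell: each of them has exactly
    one value, and these values are equal. *)
Definition TEq s t :=
  ∃ v, (∀ w, s w ↔ w == v) ∧ (∀ w, t w ↔ w == v).

Definition TVar k : term := fun v => v == k.
Definition TAdd s t : term := fun v =>
  ∃ A B k m U, s k ∧ t m ∧ Card A k ∧ Card B m ∧ U ≐ dsum A B ∧ Card U v.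
Definition TMul s t : term := fun v =>
  ∃ A B k m P, s k ∧ t m ∧ Card A k ∧ Card B m ∧ P ≐ prod A B ∧ Card P v.

Definition T0 : term := fun v => ∃ e, Zero e ∧ Card e v.
Definition T1 : term := fun v => ∃ e, One e ∧ Card e v.
Definition Tb : term := fun v =>
  ∃ e A, Zero e ∧ Bracket3 A (sing e) empty empty ∧ Card A v.
Definition Tn : term := fun v =>
  ∃ e A, Zero e ∧ Bracket3 A empty empty (sing e) ∧ Card A v.

End Vocabulary.

Declare Scope card_scope.
Delimit Scope card_scope with card.
Bind Scope card_scope with term.
Notation "s + t" := (TAdd s t) : card_scope.
Notation "s * t" := (TMul s t) : card_scope.
Notation "s ≡ t" := (TEq s%card t%card)
  (at level 70, no associativity) : bs4_scope.

Arguments T0 {M}.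
Arguments T1 {M}.
Arguments Tb {M}.
Arguments Tn {M}.

(** [t], [b], [n] are classical cardinals with [k = t + b·𝔟 + n·𝔫]. *)
Definition Decomposition (M : model) (k t b n : M) :=
  ClassicalCardinal t ∧ ClassicalCardinal b ∧ ClassicalCardinal n ∧
  TVar k ≡ TVar t + TVar b * Tb + TVar n * Tn.

(** [k_t], [k_b], [k_n]: the classical cardinals of the decomposition of [k]. *)
Definition Pt (M : model) (k : M) : term M :=
  fun v => ∃ b n : M, Decomposition k v b n.
Definition Pb (M : model) (k : M) : term M :=
  fun v => ∃ t n : M, Decomposition k t v n.
Definition Pn (M : model) (k : M) : term M :=
  fun v => ∃ t b : M, Decomposition k t b v.

Definition ax_extensionality : sentence := fun M =>
  ∀ A B : M, A == B ⇔ (∀ x, x ∈ A ⇔ x ∈ B).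

(** The quantifier over assignments [e] is the universal closure. *)
Definition ax_comprehension (f : form) : sentence := fun M =>
  ∀ e : nat -> M, ∀ A : M, ∃ B : M, B ≐ (fun x => x ∈ A ∧ eval f (scons x e)).

Definition ax_classical_superset : sentence := fun M =>
  ∀ A : M, ∃ C : M, Classical C ∧ Sub (ext A) (ext C).

(** [f(x,y)]: index 0 is [x], index 1 is [y]. *)
Definition ax_replacement (f : form) : sentence := fun M =>
  ∀ e : nat -> M, ∀ A : M,
    Classical A ∧
    (∀[x ∈ A] ∃ y, ∀ z, eval f (scons x (scons z e)) ↔ z == y) →
    ∃ B : M, B ≐ (fun y => ∃ x, x ∈ A ∧ Bang (eval f (scons x (scons y e)))).

Definition ax_pairing : sentence := fun M =>
  ∀ a b : M, ∃ C : M, C ≐ upair a b.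

Definition ax_union : sentence := fun M =>
  ∀ A : M, ∃ U : M, U ≐ (fun x => ∃ y, y ∈ A ∧ x ∈ y).

(** Without [Bang], the class [{x : x ⊆ A}] would not be a set: [x ⊆ A] is not
    false for every [x] with [x^! ⊆ A^?], however large [x^?] is. *)
Definition ax_power_set : sentence := fun M =>
  ∀ A : M, ∃ P : M, P ≐ (fun x => Bang (Sub (ext x) (ext A))).

Definition ax_infinity : sentence := fun M =>
  ∃ I : M, (∃ e, e ≐ @empty M ∧ e ∈ I) ∧
    (∀[x ∈ I] ∃ y, y ≐ (fun z => z ∈ x ∨ Bang (z == x)) ∧ y ∈ I).

(** Well-foundedness of membership in the realm [x^! ∪ x^?]. *)
Definition ax_foundation : sentence := fun M =>
  ∀ A : M, (∃ x, x ∈ A) → ∃[x ∈ A] ∀[y ∈ A] ¬ (inn x y ∨ out x y).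

Definition ax_choice : sentence := fun M =>
  ∀ C : M, Classical C ∧ (∀[x ∈ C] ∃ y, y ∈ x) →
    ∃ f : M, Function f C ∧ (∀ x y, App f x y → y ∈ x).

Definition ax_acla : sentence := fun M =>
  (∃ A : M, ∼ Sub (inn A) (out A)) ∧ (∃ A : M, ∼ Sub (out A) (inn A)).

Inductive BZFC : theory :=
| BZFC_extensionality : BZFC ax_extensionality
| BZFC_comprehension f : BZFC (ax_comprehension f)
| BZFC_classical_superset : BZFC ax_classical_superset
| BZFC_replacement f : BZFC (ax_replacement f)
| BZFC_pairing : BZFC ax_pairing
| BZFC_union : BZFC ax_union
| BZFC_power_set : BZFC ax_power_set
| BZFC_infinity : BZFC ax_infinity
| BZFC_foundation : BZFC ax_foundation
| BZFC_choice : BZFC ax_choice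
| BZFC_acla : BZFC ax_acla.

Section PairLaw.
Variable M : model.
Hypothesis hM : forall s, BZFC s -> tr (s M).
Implicit Types A B a b c d e p q s x y z w : M.

Let ext_pos A B :
  (forall x, (mem_pos x A <-> mem_pos x B) /\ (mem_neg x A <-> mem_neg x B)) ->
  A = B.
Proof.
intro h; destruct (hM BZFC_extensionality A B) as [[_ h1] _]; apply h1.
intro x; specialize (h x); simpl; tauto.
Qed.

Let ext_neg A B :
  eq_neg A B <-> exists x, (mem_pos x A /\ mem_neg x B) \/
                           (mem_neg x A /\ mem_pos x B).
Proof.
destruct (hM BZFC_extensionality A B) as [_ [h1 h2]]; split.
- intro h; destruct (h1 h) as [x hx]; exists x; simpl in hx; tauto.
- intros [x hx]; apply h2; exists x; simpl; tauto.
Qed.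

Let empty_ex : exists e, tr (e ≐ @empty M).
Proof.
destruct (dom_inhabited M) as [A].
destruct (hM (BZFC_comprehension fBot) (fun _ => A) A) as [e he].
exists e; intro x; specialize (he x); simpl in *; tauto.
Qed.

Let upair_ex a b : exists s, tr (s ≐ upair a b).
Proof. destruct (hM BZFC_pairing a b) as [s hs]; exists s; exact hs. Qed.

Let sing_ex a : exists s, tr (s ≐ sing a).
Proof.
destruct (upair_ex a a) as [s hs]; exists s; intro x; specialize (hs x).
simpl in *; tauto.
Qed.

Let set_unique A B (X : class M) : tr (A ≐ X) -> tr (B ≐ X) -> A = B.
Proof.
intros hA hB; apply ext_pos; intro x; specialize (hA x); specialize (hB x).
simpl in *; tauto.
Qed.

Let sing_mem s a x : tr (s ≐ sing a) -> (mem_pos x s <-> x = a).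
Proof. intro h; specialize (h x); simpl in h; tauto. Qed.

Let upair_mem s a b x :
  tr (s ≐ upair a b) -> (mem_pos x s <-> x = a \/ x = b).
Proof. intro h; specialize (h x); simpl in h; tauto. Qed.

Let empty_mem e x : tr (e ≐ @empty M) -> ~ mem_pos x e.
Proof. intro h; specialize (h x); simpl in h; tauto. Qed.

Let sing_inj s a b : tr (s ≐ sing a) -> tr (s ≐ sing b) -> a = b.
Proof.
intros h1 h2; apply (sing_mem a h2), (sing_mem a h1); reflexivity.
Qed.

Let sing_not_empty s a : tr (s ≐ sing a) -> ~ tr (s ≐ @empty M).
Proof.
intros h1 h2; apply (empty_mem (x := a) h2), (sing_mem a h1); reflexivity.
Qed.

Let Tag1_ex x : exists z, tr (Tag1 z x).
Proof.
destruct empty_ex as [e he]; destruct (sing_ex x) as [s hs].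
destruct (upair_ex e s) as [z hz]; exists z, e, s; exact (conj he (conj hs hz)).
Qed.

Let Tag2_ex x : exists z, tr (Tag2 z x).
Proof.
destruct (sing_ex x) as [s hs]; destruct (sing_ex s) as [z hz].
exists z, s; exact (conj hs hz).
Qed.

Let Tag1_inj z x y : tr (Tag1 z x) -> tr (Tag1 z y) -> x = y.
Proof.
intros [e [s [he [hs hz]]]] [e' [s' [he' [hs' hz']]]].
assert (h : s = e' \/ s = s').
{ apply (upair_mem s hz'), (upair_mem s hz); right; reflexivity. }
destruct h as [-> | ->].
- destruct (sing_not_empty hs he').
- exact (sing_inj hs hs').
Qed.

Let Tag2_inj z x y : tr (Tag2 z x) -> tr (Tag2 z y) -> x = y.
Proof.
intros [s [hs hz]] [s' [hs' hz']].
rewrite (sing_inj hz' hz) in hs'; exact (sing_inj hs hs').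
Qed.

Let Tag12 z x y : tr (Tag1 z x) -> ~ tr (Tag2 z y).
Proof.
intros [e [s [he [hs hz]]]] [s' [hs' hz']].
assert (h : e = s').
{ apply (sing_mem e hz'), (upair_mem e hz); left; reflexivity. }
rewrite h in he; exact (sing_not_empty hs' he).
Qed.

Let Pair_pos p a b z : tr (Pair p a b) ->
  (mem_pos z p <-> (exists x, tr (Tag1 z x) /\ mem_pos x a) \/
                   (exists x, tr (Tag2 z x) /\ mem_pos x b)).
Proof.
intro h; destruct (h z) as [[h1 h2] _].
split.
- intro hz; destruct (h1 hz) as [[x [[hx _] hx']] | [x [[hx _] hx']]].
  + left; exists x; exact (conj hx hx').
  + right; exists x; exact (conj hx hx').
- intros [[x [hx hx']] | [x [hx hx']]]; apply h2.
  + left; exists x; exact (conj (conj hx I) hx').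
  + right; exists x; exact (conj (conj hx I) hx').
Qed.

Let Pair_neg p a b z : tr (Pair p a b) ->
  (mem_neg z p <-> (forall x, ~ tr (Tag1 z x) \/ mem_neg x a) /\
                   (forall x, ~ tr (Tag2 z x) \/ mem_neg x b)).
Proof. intro h; destruct (h z) as [_ h1]; exact h1. Qed.

Let Pair_tag1 p a b z x : tr (Pair p a b) -> tr (Tag1 z x) ->
  (mem_pos z p <-> mem_pos x a) /\ (mem_neg z p <-> mem_neg x a).
Proof.
intros hp hz; rewrite (Pair_pos z hp), (Pair_neg z hp); split; split.
- intros [[y [hy hy']] | [y [hy _]]].
  + rewrite (Tag1_inj hz hy); exact hy'.
  + destruct (Tag12 hz hy).
- intro h; left; exists x; exact (conj hz h).
- intros [h _]; destruct (h x); [contradiction | assumption].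
- intro h; split; intro y; [|left; exact (Tag12 hz)].
  destruct (classic (tr (Tag1 z y))) as [hy | hy]; [right | left; exact hy].
  rewrite (Tag1_inj hy hz); exact h.
Qed.

Let Pair_tag2 p a b z x : tr (Pair p a b) -> tr (Tag2 z x) ->
  (mem_pos z p <-> mem_pos x b) /\ (mem_neg z p <-> mem_neg x b).
Proof.
intros hp hz; rewrite (Pair_pos z hp), (Pair_neg z hp); split; split.
- intros [[y [hy _]] | [y [hy hy']]].
  + destruct (Tag12 hy hz).
  + rewrite (Tag2_inj hz hy); exact hy'.
- intro h; right; exists x; exact (conj hz h).
- intros [_ h]; destruct (h x); [contradiction | assumption].
- intro h; split; intro y; [left; intro hy; exact (Tag12 hy hz)|].
  destruct (classic (tr (Tag2 z y))) as [hy | hy]; [right | left; exact hy].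
  rewrite (Tag2_inj hy hz); exact h.
Qed.

Lemma pair_law p q a b c d : tr (Pair p a b) -> tr (Pair q c d) ->
  tr (p == q ⇔ (a == c ∧ b == d)).
Proof.
intros hp hq; split; split.
- simpl; intros <-; split; apply ext_pos; intro x.
  + destruct (Tag1_ex x) as [z hz].
    pose proof (Pair_tag1 hp hz); pose proof (Pair_tag1 hq hz); tauto.
  + destruct (Tag2_ex x) as [z hz].
    pose proof (Pair_tag2 hp hz); pose proof (Pair_tag2 hq hz); tauto.
- simpl; intros [<- <-]; exact (set_unique hp hq).
- simpl; rewrite !ext_neg; intros [z hz].
  destruct (classic (exists x, tr (Tag1 z x))) as [[x hx] | h1].
  { pose proof (Pair_tag1 hp hx); pose proof (Pair_tag1 hq hx).
    left; exists x; tauto. }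
  destruct (classic (exists x, tr (Tag2 z x))) as [[x hx] | h2].
  { pose proof (Pair_tag2 hp hx); pose proof (Pair_tag2 hq hx).
    right; exists x; tauto. }
  exfalso; rewrite (Pair_pos z hp), (Pair_pos z hq) in hz.
  destruct hz as [[[[x [hx _]] | [x [hx _]]] _]
                 | [_ [[x [hx _]] | [x [hx _]]]]].
  + apply h1; exists x; exact hx.
  + apply h2; exists x; exact hx.
  + apply h1; exists x; exact hx.
  + apply h2; exists x; exact hx.
- simpl; rewrite !ext_neg; intros [[x hx] | [x hx]].
  + destruct (Tag1_ex x) as [z hz]; exists z.
    pose proof (Pair_tag1 hp hz); pose proof (Pair_tag1 hq hz); tauto.
  + destruct (Tag2_ex x) as [z hz]; exists z.
    pose proof (Pair_tag2 hp hz); pose proof (Pair_tag2 hq hz); tauto.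
Qed.

End PairLaw.

(* Main.v *)
From Stdlib Require Import Classical ClassicalEpsilon FunctionalExtensionality.
From Stdlib Require Import PeanoNat Setoid Ring.
Require Import Defs.

(** A set [A] is determined by the classical sets [A_t], [A_b], [A_n], and [|A|]
    by their cardinalities: [|A^!|] and [|A^?|] are the sums of those of [A_t]
    and [A_b], respectively [A_n].  The parts of [A ⊎ B] are the disjoint unions
    of the parts; those of [A × B] are [A_t × B_t], the pairs with both
    components in [A^!], [B^!] but not both in [A_t], [B_t], and the pairs with
    both components in [A^?], [B^?] but not both in [A_t], [B_t].  So cardinal
    numbers behave as triples [(t, b, n)] of classical cardinals with
    componentwise sum and
    [(t,b,n)(t',b',n') = (tt', tb' + bt' + bb', tn' + nt' + nn')], where [𝔟] is
    [(0,1,0)] and [𝔫] is [(0,0,1)], and the claims are identities in the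
    commutative semiring of classical cardinals.

    That the terms have values at all rests on the well-ordering theorem for
    classical sets, proved inside an arbitrary model of BZFC from Choice and
    Replacement. *)

Set Implicit Arguments.
Unset Strict Implicit.
Unset Printing Implicit Defensive.

(** * Definability *)

(** The main obstacle is that Comprehension and Replacement range over syntactic formulas, while the
    argument uses predicates on an arbitrary model. [Def] singles out the predicates whose truth
    some formula with parameters expresses, and the tactic [def] establishes it along the structure
    of the predicate. Matching truth alone is enough: [sep] and [repl] place such formulas under
    [Bang] and yield classical sets, and a set with prescribed truth and falsity of membership is
    assembled from two classical sets by [bracket_ex]. Equipotence [eqp] looks at true membership
    only. It is therefore an equivalence relation on the whole domain, on which sums and products
    are total operations picked by [epsilon]. The domain itself, with [eqp] as setoid equality,
    serves as the semiring of classical cardinals, so that [ring] applies and no type of cardinals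
    is built. Finally, an equation between descriptive terms also asserts that both sides have
    exactly one value. The invariant [rep] carries this through sums and products and reduces each
    equation to three equipotences. *)

Fixpoint ren (r : nat -> nat) (f : form) : form :=
  let up r n := match n with O => O | S n => S (r n) end in
  match f with
  | fMem i j => fMem (r i) (r j)
  | fEql i j => fEql (r i) (r j)
  | fBot => fBot
  | fNot f => fNot (ren r f)
  | fAnd f g => fAnd (ren r f) (ren r g)
  | fOr f g => fOr (ren r f) (ren r g)
  | fTo f g => fTo (ren r f) (ren r g)
  | fEquiv f g => fEquiv (ren r f) (ren r g)
  | fAll f => fAll (ren (up r) f)
  | fEx f => fEx (ren (up r) f)
  end.

Lemma eval_ren (M : model) f :
  forall r (e : nat -> M), eval (ren r f) e = eval f (fun n => e (r n)).
Proof.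
induction f as [| | |f IH|f IHf g IHg|f IHf g IHg|f IHf g IHg|f IHf g IHg
               |f IH|f IH]; intros r e; simpl;
  rewrite ?IH, ?IHf, ?IHg; trivial;
  f_equal; apply functional_extensionality; intro x; rewrite IH; f_equal;
  apply functional_extensionality; intros [|n]; reflexivity.
Qed.

Section Definability.
Variable M : model.
Implicit Types (P Q : (nat -> M) -> Prop) (t u v : (nat -> M) -> M).

Definition env (s : nat -> nat + M) (e : nat -> M) (n : nat) : M :=
  match s n with inl i => e i | inr c => c end.

(** [s] tells which variables of the formula [f] stand for parameters. *)
Definition Def P := exists f s, forall e, tr (eval f (env s e)) <-> P e.

(** The language has no function symbols, so an operation on sets counts as definable when its graph
    is; slot 0 holds the value. *)
Definition DefT t := Def (fun e => e 0 = t (fun n => e (S n))).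

(** The two formulas come with their own parameters. Moving the variables of the first to even and
    those of the second to odd indices lets a single assignment [s] serve both. *)
Lemma def_merge P Q : Def P -> Def Q ->
  exists f g s, forall e, (tr (eval f (env s e)) <-> P e) /\
                          (tr (eval g (env s e)) <-> Q e).
Proof.
intros [f [s hf]] [g [s' hg]].
exists (ren (fun n => 2 * n) f), (ren (fun n => S (2 * n)) g),
  (fun n => if Nat.even n then s (Nat.div2 n) else s' (Nat.div2 n)).
intro e; rewrite <- hf, <- hg, !eval_ren.
assert (h : (fun n => env (fun n => if Nat.even n then s (Nat.div2 n)
                                    else s' (Nat.div2 n)) e (2 * n)) = env s e).
{ apply functional_extensionality; intro n; unfold env.
  rewrite Nat.even_even, Nat.div2_double; reflexivity. }
assert (h' : (fun n => env (fun n => if Nat.even n then s (Nat.div2 n)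
                          else s' (Nat.div2 n)) e (S (2 * n))) = env s' e).
{ apply functional_extensionality; intro n; unfold env.
  replace (Nat.even (S (2 * n))) with false;
    [rewrite Nat.div2_succ_double; reflexivity|].
  rewrite Nat.even_succ, <- Nat.negb_even, Nat.even_even; reflexivity. }
rewrite h, h'; tauto.
Qed.

Lemma def_iff P Q : (forall e, P e <-> Q e) -> Def P -> Def Q.
Proof. intros h [f [s hf]]; exists f, s; intro e; rewrite hf; apply h. Qed.

Lemma def_mem_pos i j : Def (fun e => mem_pos (e i) (e j)).
Proof. exists (fMem i j), inl; intro e; simpl; tauto. Qed.

Lemma def_mem_neg i j : Def (fun e => mem_neg (e i) (e j)).
Proof. exists (fNot (fMem i j)), inl; intro e; simpl; tauto. Qed.

Lemma def_eq i j : Def (fun e => e i = e j).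
Proof. exists (fEql i j), inl; intro e; simpl; tauto. Qed.

Lemma def_False : Def (fun _ => False).
Proof. exists fBot, inl; intro e; simpl; tauto. Qed.

Lemma def_and P Q : Def P -> Def Q -> Def (fun e => P e /\ Q e).
Proof.
intros hP hQ; destruct (def_merge hP hQ) as [f [g [s h]]].
exists (fAnd f g), s; intro e; destruct (h e); simpl; tauto.
Qed.

Lemma def_or P Q : Def P -> Def Q -> Def (fun e => P e \/ Q e).
Proof.
intros hP hQ; destruct (def_merge hP hQ) as [f [g [s h]]].
exists (fOr f g), s; intro e; destruct (h e); simpl; tauto.
Qed.

Lemma def_imp P Q : Def P -> Def Q -> Def (fun e => P e -> Q e).
Proof.
intros hP hQ; destruct (def_merge hP hQ) as [f [g [s h]]].
exists (fTo f g), s; intro e; destruct (h e); simpl; tauto.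
Qed.

Lemma def_not P : Def P -> Def (fun e => ~ P e).
Proof. intro h; exact (def_imp h def_False). Qed.

Lemma def_True : Def (fun _ => True).
Proof.
apply (def_iff (P := fun _ => ~ False)); [tauto|exact (def_not def_False)].
Qed.

Lemma def_equiv P Q : Def P -> Def Q -> Def (fun e => P e <-> Q e).
Proof. intros hP hQ; exact (def_and (def_imp hP hQ) (def_imp hQ hP)). Qed.

(** Several variables of a formula may stand for slot 0, so quantifying over that slot first
    identifies all of them with the de Bruijn index 0. The value [inl 0] that [unbound] leaves in
    place is never read, as those variables have been renamed away. *)
Let bound (s : nat -> nat + M) (n : nat) : nat :=
  match s n with inl O => O | _ => S n end.
Let unbound (s : nat -> nat + M) (n : nat) : nat + M :=
  match s n with inl (S i) => inl i | v => v end.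

Let env_bound s e x :
  (fun n => scons x (env (unbound s) e) (bound s n)) = env s (scons x e).
Proof.
apply functional_extensionality; intro n; unfold bound, env.
destruct (s n) as [[|i]|c] eqn:h; simpl; unfold unbound; rewrite ?h; reflexivity.
Qed.

Lemma def_ex (P : (nat -> M) -> M -> Prop) :
  Def (fun e => P (fun n => e (S n)) (e 0)) -> Def (fun e => exists x, P e x).
Proof.
intros [f [s h]]; exists (fEx (ren (bound s) f)), (unbound s); intro e; simpl.
split; intros [x hx]; exists x; revert hx; rewrite eval_ren, env_bound, h;
  exact (fun h => h).
Qed.

Lemma def_all (P : (nat -> M) -> M -> Prop) :
  Def (fun e => P (fun n => e (S n)) (e 0)) -> Def (fun e => forall x, P e x).
Proof.
intros [f [s h]]; exists (fAll (ren (bound s) f)), (unbound s); intro e; simpl.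
split; intros hx x; specialize (hx x); revert hx;
  rewrite eval_ren, env_bound, h; exact (fun h => h).
Qed.

Lemma def_shift (r : nat -> nat) P :
  Def P -> Def (fun e => P (fun n => e (r n))).
Proof.
intros [f [s h]].
exists f, (fun n => match s n with inl i => inl (r i) | v => v end); intro e.
rewrite <- h; replace (env _ e) with (env s (fun n => e (r n))); [tauto|].
apply functional_extensionality; intro n; unfold env.
destruct (s n); reflexivity.
Qed.

Lemma defT_var i : DefT (fun e => e i).
Proof. exact (def_eq 0 (S i)). Qed.

Lemma defT_const (c : M) : DefT (fun _ => c).
Proof.
exists (fEql 0 1), (fun n => match n with 0 => inl 0 | _ => inr c end).
intro e; simpl; tauto.
Qed.

Lemma defT_shift (r : nat -> nat) t :
  DefT t -> DefT (fun e => t (fun n => e (r n))).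
Proof.
intro h.
exact (def_shift (fun n => match n with 0 => 0 | S n => S (r n) end) h).
Qed.

(** Substitution of a term, expressed by quantifying over its value. With several arguments the
    quantifiers nest, and each inner term is shifted past the values already introduced. *)
Lemma def_app1 (P : M -> Prop) t :
  Def (fun e => P (e 0)) -> DefT t -> Def (fun e => P (t e)).
Proof.
intros hP ht; apply def_iff with (fun e => exists x, x = t e /\ P x).
- intro e; split; [intros [x [-> h]]; exact h | intro h; exists (t e); tauto].
- exact (def_ex (P := fun e x => x = t e /\ P x) (def_and ht hP)).
Qed.

Lemma def_app2 (P : M -> M -> Prop) t u :
  Def (fun e => P (e 0) (e 1)) -> DefT t -> DefT u ->
  Def (fun e => P (t e) (u e)).
Proof.
intros hP ht hu; apply def_iff with (fun e => exists y, y = u e /\ P (t e) y).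
- intro e; split; [intros [y [-> h]]; exact h | intro h; exists (u e); tauto].
- apply (def_ex (P := fun e y => y = u e /\ P (t e) y)), def_and; [exact hu|].
  apply def_iff with (fun e => exists x, x = t (fun n => e (S n)) /\ P x (e 0)).
  + intro e; split; [intros [x [-> h]]; exact h|].
    intro h; exists (t (fun n => e (S n))); tauto.
  + apply (def_ex (P := fun e x => x = t (fun n => e (S n)) /\ P x (e 0))).
    apply def_and; [exact (defT_shift S ht)|exact hP].
Qed.

Lemma def_app3 (P : M -> M -> M -> Prop) t u v :
  Def (fun e => P (e 0) (e 1) (e 2)) -> DefT t -> DefT u -> DefT v ->
  Def (fun e => P (t e) (u e) (v e)).
Proof.
intros hP ht hu hv.
apply def_iff with (fun e => exists z, z = v e /\ P (t e) (u e) z).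
- intro e; split; [intros [z [-> h]]; exact h | intro h; exists (v e); tauto].
- apply (def_ex (P := fun e z => z = v e /\ P (t e) (u e) z)), def_and;
    [exact hv|].
  apply def_iff with (fun e => exists y, y = u (fun n => e (S n)) /\
    exists x, x = t (fun n => e (S n)) /\ P x y (e 0)).
  + intro e; split; [intros [y [-> [x [-> h]]]]; exact h|].
    intro h; exists (u (fun n => e (S n))); split; [trivial|].
    exists (t (fun n => e (S n))); tauto.
  + apply (def_ex (P := fun e y => y = u (fun n => e (S n)) /\
      exists x, x = t (fun n => e (S n)) /\ P x y (e 0))), def_and.
    * exact (defT_shift S hu).
    * apply (def_ex (P := fun e x =>
        x = t (fun n => e (S (S n))) /\ P x (e 0) (e 1))), def_and.
      -- exact (defT_shift (fun n => S (S n)) ht).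
      -- exact hP.
Qed.

(** Brings a definable relation into the shape the Replacement schema expects: indices 0 and 1 are
    the arguments and all others are parameters. *)
Lemma def_formula2 (P : M -> M -> Prop) : Def (fun e => P (e 0) (e 1)) ->
  exists f e, forall x y, tr (eval f (scons x (scons y e))) <-> P x y.
Proof.
intros [f [s h]]; destruct (dom_inhabited M) as [d].
(* Variables for slots beyond 1 may occur in [f], but [P] does not depend on them; they are all
   given the arbitrary value [d]. *)
exists (ren (fun n => match s n with inl 0 => 0 | inl 1 => 1 | _ => S (S n) end)
            f), (env s (fun _ => d)).
intros x y; rewrite <- (h (scons x (scons y (fun _ => d)))), eval_ren.
replace (fun n => _) with (env s (scons x (scons y (fun _ => d)))); [tauto|].
apply functional_extensionality; intro n; unfold env.
destruct (s n) as [[|[|i]]|c] eqn:hn; simpl; rewrite ?hn; reflexivity.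
Qed.

Lemma def_formula1 (P : M -> Prop) : Def (fun e => P (e 0)) ->
  exists f e, forall x, tr (eval f (scons x e)) <-> P x.
Proof.
intro h; destruct (def_formula2 (P := fun x _ => P x) h) as [f [e hf]].
destruct (dom_inhabited M) as [d]; exists f, (scons d e); intro x; apply hf.
Qed.

End Definability.

(** Extension point: it is redefined once [Tag1], [Tag2] and later [pr] are known to be
    definable. *)
Ltac def_hook := fail.

Ltac def_step :=
  cbv beta;
  lazymatch goal with
  | |- DefT (fun e => e ?i) => apply defT_var
  | |- DefT (fun _ => ?c) => apply defT_const
  | |- Def (fun e => exists x, @?P e x) => refine (def_ex (P := P) _)
  | |- Def (fun e => @?P e /\ @?Q e) => refine (def_and (P := P) (Q := Q) _ _)
  | |- Def (fun e => @?P e \/ @?Q e) => refine (def_or (P := P) (Q := Q) _ _)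
  | |- Def (fun e => @?P e <-> @?Q e) => refine (def_equiv (P := P) (Q := Q) _ _)
  | |- Def (fun e => ~ @?P e) => refine (def_not (P := P) _)
  | |- Def (fun _ => True) => apply def_True
  | |- Def (fun _ => False) => apply def_False
  | |- Def (fun e => @?P e -> @?Q e) => refine (def_imp (P := P) (Q := Q) _ _)
  | |- Def (fun e => forall x, @?P e x) => refine (def_all (P := P) _)
  | |- Def (fun e => mem_pos (@?t e) (@?u e)) =>
      refine (def_app2 (def_mem_pos _ 0 1) (t := t) (u := u) _ _)
  | |- Def (fun e => mem_neg (@?t e) (@?u e)) =>
      refine (def_app2 (def_mem_neg _ 0 1) (t := t) (u := u) _ _)
  | |- Def (fun e => @eq _ (@?t e) (@?u e)) =>
      refine (def_app2 (def_eq _ 0 1) (t := t) (u := u) _ _)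
  | H : Def (fun e => ?P (e 0) (e 1)) |- Def (fun e => ?P (@?t e) (@?u e)) =>
      refine (def_app2 (P := P) H (t := t) (u := u) _ _)
  | H : Def (fun e => ?P (e 0)) |- Def (fun e => ?P (@?t e)) =>
      refine (def_app1 (P := P) H (t := t) _)
  | |- _ => def_hook
  end.

Ltac def := repeat def_step.
(** * Classical sets *)

(** A proposition of the metatheory, in contrast to the four-valued [∈]. *)
Notation "x ∊ A" := (mem_pos x A) (at level 70, no associativity).

Lemma def_Tag1 (M : model) :
  Def (fun e : nat -> M => tr (Tag1 (e 0) (e 1))).
Proof. unfold Tag1, IsSet, sing, upair, empty, Bang; simpl; def. Qed.

Lemma def_Tag2 (M : model) :
  Def (fun e : nat -> M => tr (Tag2 (e 0) (e 1))).
Proof. unfold Tag2, IsSet, sing, upair, empty, Bang; simpl; def. Qed.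

Lemma def_Pair (M : model) :
  Def (fun e : nat -> M => tr (Pair (e 0) (e 1) (e 2))).
Proof.
unfold Pair, Tag1, Tag2, IsSet, sing, upair, empty, Bang; simpl; def.
Qed.

Ltac def_hook ::=
  match goal with
  | |- Def (fun e => tr (Tag1 (@?t e) (@?u e))) =>
      refine (def_app2 (P := fun z x => tr (Tag1 z x)) (@def_Tag1 _)
                (t := t) (u := u) _ _)
  | |- Def (fun e => tr (Tag2 (@?t e) (@?u e))) =>
      refine (def_app2 (P := fun z x => tr (Tag2 z x)) (@def_Tag2 _)
                (t := t) (u := u) _ _)
  end.

Section Classical.
Variable M : model.
Hypothesis hM : forall s, BZFC s -> tr (s M).
Implicit Types A B C a b c d f p q r s x y z w : M.

Definition cls A := forall x, mem_neg x A <-> ~ x ∊ A.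

Lemma Classical_cls A : tr (Classical A) <-> cls A.
Proof.
unfold Classical, cls; simpl; split; intros h x; specialize (h x).
- tauto.
- destruct (classic (x ∊ A)); tauto.
Qed.

(** For a two-valued class term the falsity half of [⇔] says just that the set is classical. *)
Lemma IsSet_cls A (X : class M) : (forall x, fa (X x) <-> ~ tr (X x)) ->
  tr (IsSet A X) <-> cls A /\ (forall x, x ∊ A <-> tr (X x)).
Proof.
intro hX; unfold IsSet, cls; simpl; split.
- intro h; split; intro x; specialize (h x); specialize (hX x); tauto.
- intros [h h'] x; specialize (h x); specialize (h' x); specialize (hX x); tauto.
Qed.

Lemma set_ext A B :
  (forall x, (x ∊ A <-> x ∊ B) /\ (mem_neg x A <-> mem_neg x B)) -> A = B.
Proof.
intro h; destruct (hM BZFC_extensionality A B) as [[_ h1] _]; apply h1.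
intro x; specialize (h x); simpl; tauto.
Qed.

Lemma cls_ext A B : cls A -> cls B -> (forall x, x ∊ A <-> x ∊ B) -> A = B.
Proof.
intros hA hB h; apply set_ext; intro x; split; [apply h|].
rewrite (hA x), (hB x), (h x); tauto.
Qed.

Lemma IsSet_unique A B (X : class M) : tr (IsSet A X) -> tr (IsSet B X) -> A = B.
Proof.
intros hA hB; apply set_ext; intro x; specialize (hA x); specialize (hB x).
simpl in *; tauto.
Qed.

(** [C] covers the whole realm of [A]: the contrapositive half of [⇒] makes everything outside the
    classical set [C] a false element of [A]. *)
Lemma superset A :
  exists C, cls C /\ forall x, (x ∊ A -> x ∊ C) /\ (~ mem_neg x A -> x ∊ C).
Proof.
destruct (hM BZFC_classical_superset A) as [C [hC h]].
apply Classical_cls in hC.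
exists C; split; [exact hC|]; intro x; specialize (hC x); destruct (h x).
simpl in *; split; [tauto|intro hx]; apply NNPP; tauto.
Qed.

(** The formula for [x ∊ A /\ P x] is put under [Bang] and cut out of a classical superset, so the
    result is classical whatever [A] is. With [P] constantly true this produces [A^!], a use that
    recurs below. *)
Lemma sep A (P : M -> Prop) : Def (fun e => P (e 0)) ->
  exists B, cls B /\ forall x, x ∊ B <-> x ∊ A /\ P x.
Proof.
intro hP; destruct (superset A) as [C [hC hAC]].
assert (hQ : Def (fun e => e 0 ∊ A /\ P (e 0))) by def.
destruct (def_formula1 (P := fun x => x ∊ A /\ P x) hQ) as [f [e hf]].
destruct (hM (BZFC_comprehension (fNot (fTo f fBot))) e C) as [B hB].
exists B; apply IsSet_cls in hB.
- destruct hB as [hB h]; split; [exact hB|]; intro x.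
  specialize (hf x); specialize (hAC x); specialize (h x); simpl in h; tauto.
- intro x; specialize (hC x); simpl; destruct (classic (x ∊ C)); tauto.
Qed.

Lemma repl (R : M -> M -> Prop) A :
  Def (fun e => R (e 0) (e 1)) ->
  (forall x y z, x ∊ A -> R x y -> R x z -> y = z) ->
  exists B, cls B /\ forall y, y ∊ B <-> exists x, x ∊ A /\ R x y.
Proof.
(* The axiom requires a value for every element of a classical set, whereas [R] may be partial and
   [A] non-classical; hence the restriction to the domain [D]. *)
intros hR hA; destruct (sep A (P := fun x => exists y, R x y)) as [D [hD hDA]].
{ def. }
destruct (def_formula2 hR) as [f [e hf]].
destruct (hM (BZFC_replacement f) e D) as [B hB].
{ simpl; split; [apply Classical_cls; exact hD|].
  intros x hx; apply hDA in hx; destruct hx as [hx [y hy]]; exists y; intro z.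
  rewrite hf; split; [intro hz; exact (hA x z y hx hz hy)|intros ->; exact hy]. }
exists B; apply IsSet_cls in hB.
- destruct hB as [hB h]; split; [exact hB|]; intro y; rewrite h; simpl.
  split; intros [x hx]; exists x; rewrite hf, hDA in *; [tauto|].
  destruct hx; repeat split; trivial; exists y; assumption.
- intro y; simpl; split.
  + intros h [x [hx [hx' _]]]; destruct (h x) as [h'|h']; [|tauto].
    apply hD in h'; contradiction.
  + intros h x; rewrite (hD x); destruct (classic (x ∊ D)); [right|tauto].
    intro h'; apply h; exists x; tauto.
Qed.

Lemma upair_ex a b : exists C, cls C /\ forall x, x ∊ C <-> x = a \/ x = b.
Proof.
destruct (hM BZFC_pairing a b) as [C hC]; exists C; apply IsSet_cls in hC.
- destruct hC as [hC h]; split; [exact hC|]; intro x; rewrite h; simpl; tauto.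
- intro x; simpl; tauto.
Qed.

Lemma union_ex A :
  exists U, cls U /\ forall x, x ∊ U <-> exists y, y ∊ A /\ x ∊ y.
Proof.
destruct (hM BZFC_union A) as [U hU].
destruct (sep U (P := fun _ => True)) as [V [hV h]]; [def|].
exists V; split; [exact hV|]; intro x; rewrite h.
destruct (hU x) as [h1 _]; simpl in h1; tauto.
Qed.

Lemma cup_ex A B : exists C, cls C /\ forall x, x ∊ C <-> x ∊ A \/ x ∊ B.
Proof.
destruct (upair_ex A B) as [D [_ hD]]; destruct (union_ex D) as [U [hU h]].
exists U; split; [exact hU|]; intro x; rewrite h; split.
- intros [y [hy hx]]; apply hD in hy; destruct hy as [-> | ->]; tauto.
- intros [hx|hx]; [exists A|exists B]; rewrite hD; tauto.
Qed.

Lemma power_ex A :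
  exists P, forall x, cls A -> cls x -> (forall z, z ∊ x -> z ∊ A) -> x ∊ P.
Proof.
destruct (hM BZFC_power_set A) as [P hP]; exists P; intros x hA hx h.
apply (hP x); simpl; split; [|trivial]; intro z; specialize (h z).
rewrite (hA z), (hx z); tauto.
Qed.

Lemma foundation A : (exists x, x ∊ A) ->
  exists x, x ∊ A /\ forall y, y ∊ A -> ~ y ∊ x.
Proof.
intro h; destruct (hM BZFC_foundation A h) as [x [hx hx']].
exists x; split; [exact hx|]; intros y hy; specialize (hx' y hy).
simpl in hx'; tauto.
Qed.

Lemma mem_irrefl x : ~ x ∊ x.
Proof.
destruct (upair_ex x x) as [s [_ hs]]; destruct (@foundation s) as [y [hy h]].
- exists x; apply hs; tauto.
- apply hs in hy; intro hx; apply (h x); [apply hs; tauto|].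
  destruct hy as [-> | ->]; exact hx.
Qed.

(** ACLA supplies one membership statement that is both true and false and one
    that is neither. *)
Lemma bracket_ex X Y : exists B, forall x,
  (x ∊ B <-> x ∊ X) /\ (mem_neg x B <-> ~ x ∊ Y).
Proof.
destruct (hM BZFC_acla) as [[A1 [x1 h1]] [A2 [x2 h2]]]; simpl in h1, h2.
destruct (cup_ex X Y) as [C [hC hXY]].
destruct (sep X (P := fun _ => True)) as [X' [cX' hX']]; [def|].
destruct (sep Y (P := fun _ => True)) as [Y' [cY' hY']]; [def|].
(* Here [x1 ∈ A1] is both true and false, and [x2 ∈ A2] is neither. The first disjunct is true
   exactly on [X'] and false everywhere; the second is true nowhere and false exactly off [Y']. So
   the disjunction is true on [X'] and false off [Y']. *)
destruct (hM (BZFC_comprehension (fOr (fAnd (fMem 0 1) (fMem 2 3))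
                                      (fAnd (fMem 0 4) (fMem 5 6))))
  (scons X' (scons x1 (scons A1 (scons Y' (scons x2 (fun _ => A2)))))) C)
  as [B hB].
exists B; intro x; destruct (hB x) as [[p q] [p' q']]; simpl in *.
rewrite (hC x), (cX' x), (cY' x), (hXY x), (hX' x), (hY' x) in *.
split; split; intro h.
- apply p in h; clear - h h2; tauto.
- apply q; clear - h h1; tauto.
- apply p' in h; clear - h h2; tauto.
- apply q'; clear - h h1; tauto.
Qed.

Lemma bracket_class_ex C (P Q : M -> Prop) :
  Def (fun e => P (e 0)) -> Def (fun e => Q (e 0)) ->
  (forall x, P x \/ Q x -> x ∊ C) ->
  exists B, forall x, (x ∊ B <-> P x) /\ (mem_neg x B <-> ~ Q x).
Proof.
intros hP hQ h; destruct (sep C hP) as [X [_ hX]].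
destruct (sep C hQ) as [Y [_ hY]]; destruct (bracket_ex X Y) as [B hB].
exists B; intro x; specialize (h x); destruct (hB x) as [h1 h2].
rewrite h1, h2, hX, hY; tauto.
Qed.

(** * Ordered pairs *)

Lemma Tag1_unique x z z' : tr (Tag1 z x) -> tr (Tag1 z' x) -> z = z'.
Proof.
intros [e [s [he [hs hz]]]] [e' [s' [he' [hs' hz']]]].
rewrite <- (IsSet_unique he he'), <- (IsSet_unique hs hs') in hz'.
exact (IsSet_unique hz hz').
Qed.

Lemma Tag2_unique x z z' : tr (Tag2 z x) -> tr (Tag2 z' x) -> z = z'.
Proof.
intros [s [hs hz]] [s' [hs' hz']]; rewrite <- (IsSet_unique hs hs') in hz'.
exact (IsSet_unique hz hz').
Qed.

(** Replacement sends supersets of [a] and [b] to sets of tags. Their union bounds both the true and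
    the non-false elements of the pair, which [bracket_class_ex] then prescribes separately. *)
Lemma Pair_ex a b : exists p, tr (Pair p a b).
Proof.
destruct (superset a) as [A [_ hA]]; destruct (superset b) as [B [_ hB]].
destruct (repl (R := fun x z => tr (Tag1 z x)) (A := A)) as [C [_ hC]];
  [def|intros x y z _; apply Tag1_unique|].
destruct (repl (R := fun x z => tr (Tag2 z x)) (A := B)) as [D [_ hD]];
  [def|intros x y z _; apply Tag2_unique|].
destruct (cup_ex C D) as [E [_ hE]].
destruct (bracket_class_ex (C := E)
  (P := fun z => (exists x, tr (Tag1 z x) /\ x ∊ a) \/
                 (exists x, tr (Tag2 z x) /\ x ∊ b))
  (Q := fun z => (exists x, tr (Tag1 z x) /\ ~ mem_neg x a) \/
                 (exists x, tr (Tag2 z x) /\ ~ mem_neg x b))) as [p hp];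
  [def|def| |].
- intros z h; apply hE; rewrite hC, hD.
  destruct h as [[[x hx]|[x hx]]|[[x hx]|[x hx]]]; [left|right|left|right];
    exists x; specialize (hA x); specialize (hB x); tauto.
- exists p; intro z; destruct (hp z) as [h1 h2]; split.
  + change (tr (z ∈ p)%bs4) with (z ∊ p).
    split; [intro h; apply h1 in h|intro h; apply h1];
      (destruct h as [[x hx]|[x hx]]; [left|right]; exists x; simpl in *; tauto).
  + change (mem_neg z p <->
      (forall x, ~ tr (Tag1 z x) \/ mem_neg x a) /\
      (forall x, ~ tr (Tag2 z x) \/ mem_neg x b)).
    rewrite h2; split.
    * intro h; split; intro x; apply NNPP; intro h'; apply h;
        [left|right]; exists x; tauto.
    * intros [h h'] [[x hx]|[x hx]]; [destruct (h x)|destruct (h' x)]; tauto.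
Qed.

(** A choice made in the metatheory; since pairs are unique, its graph is still given by the formula
    [Pair], which is what [defT_pr] uses. *)
Definition pr a b : M := epsilon (dom_inhabited M) (fun p => tr (Pair p a b)).

Lemma Pair_pr p a b : tr (Pair p a b) <-> p = pr a b.
Proof.
assert (h : tr (Pair (pr a b) a b)) by
  exact (epsilon_spec (dom_inhabited M) _ (Pair_ex a b)).
split; [intro hp; exact (IsSet_unique hp h)|intros ->; exact h].
Qed.

Lemma pr_inj a b c d : pr a b = pr c d -> a = c /\ b = d.
Proof.
assert (h : tr (Pair (pr a b) a b)) by (apply Pair_pr; trivial).
assert (h' : tr (Pair (pr c d) c d)) by (apply Pair_pr; trivial).
destruct (pair_law hM h h') as [[h1 _] _]; exact h1.
Qed.

Lemma defT_pr (t u : (nat -> M) -> M) :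
  DefT t -> DefT u -> DefT (fun e => pr (t e) (u e)).
Proof.
intros ht hu; apply (def_iff (P := fun e =>
  tr (Pair (e 0) (t (fun n => e (S n))) (u (fun n => e (S n)))))).
- intro e; apply Pair_pr.
- apply (def_app3 (P := fun p x y => tr (Pair p x y)) (@def_Pair M)
      (t := fun e => e 0));
    [def|exact (defT_shift S ht)|exact (defT_shift S hu)].
Qed.

Definition zero : M := epsilon (dom_inhabited M) (fun e => tr (Zero e)).
Definition one : M := epsilon (dom_inhabited M) (fun e => tr (One e)).

Lemma Zero_zero e : tr (Zero e) <-> e = zero.
Proof.
assert (h : tr (Zero zero)).
{ apply (epsilon_spec (dom_inhabited M) (fun e => tr (Zero e))).
  destruct (dom_inhabited M) as [a].
  destruct (sep a (P := fun _ => False)) as [e' [he he']]; [def|].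
  exists e'; apply IsSet_cls; [simpl; tauto|split; [exact he|]].
  intro x; rewrite he'; simpl; tauto. }
split; [intro he; exact (IsSet_unique he h)|intros ->; exact h].
Qed.

Lemma zero_cls : cls zero.
Proof.
pose proof (proj2 (Zero_zero zero) (eq_refl _)) as h.
apply IsSet_cls in h; [tauto|simpl; tauto].
Qed.

Lemma in_zero x : ~ x ∊ zero.
Proof.
pose proof (proj2 (Zero_zero zero) (eq_refl _)) as h.
apply IsSet_cls in h; [|simpl; tauto]; intro hx; apply (proj2 h) in hx; exact hx.
Qed.

Lemma One_one e : tr (One e) <-> e = one.
Proof.
assert (h : tr (One one)).
{ apply (epsilon_spec (dom_inhabited M) (fun e => tr (One e))).
  destruct (upair_ex zero zero) as [s [hs h]].
  exists s, zero; split; [apply Zero_zero; trivial|].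
  apply IsSet_cls; [simpl; tauto|]; split; [exact hs|].
  intro x; rewrite h; simpl; tauto. }
split; [|intros ->; exact h].
destruct h as [z [hz h]]; intros [z' [hz' h']].
apply Zero_zero in hz; apply Zero_zero in hz'; subst.
exact (IsSet_unique h' h).
Qed.

Lemma one_spec : cls one /\ forall x, x ∊ one <-> x = zero.
Proof.
destruct (proj2 (One_one one) (eq_refl _)) as [z [hz h]].
apply Zero_zero in hz; subst z; apply IsSet_cls in h; [|simpl; tauto].
destruct h as [h h']; split; [exact h|]; intro x; rewrite h'; simpl; tauto.
Qed.

Lemma zero_neq_one : zero <> one.
Proof.
intro h; apply (@in_zero zero); rewrite h at 2; apply one_spec; reflexivity.
Qed.

Ltac def_hook ::=
  match goal with
  | |- DefT (fun e => pr (@?t e) (@?u e)) =>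
      refine (defT_pr (t := t) (u := u) _ _)
  end.

Ltac pairs :=
  repeat (intros; match goal with
  | H : exists _, _ |- _ => destruct H
  | H : _ /\ _ |- _ => destruct H
  | H : _ \/ _ |- _ => destruct H
  | H : pr _ _ = pr _ _ |- _ => apply pr_inj in H
  | H : zero = one |- _ => destruct (zero_neq_one H)
  | H : one = zero |- _ => destruct (zero_neq_one (eq_sym H))
  | H : _ ∊ zero |- _ => destruct (in_zero H)
  | H : _ = _ |- _ => progress (subst; trivial)
  end); trivial.

Lemma times_ex A B :
  exists C, cls C /\ forall z, z ∊ C <-> exists x y, x ∊ A /\ y ∊ B /\ z = pr x y.
Proof.
(* Each [x] is sent to the slice of pairs with first component [x]; the product is the union of the
   slices. Requiring [cls s] makes the slice unique. *)
destruct (repl (A := A) (R := fun x s => cls s /\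
  forall z, z ∊ s <-> exists y, y ∊ B /\ z = pr x y)) as [D [_ hD]].
- unfold cls; def.
- intros x s s' _ [hs h] [hs' h']; apply cls_ext; trivial.
  intro z; rewrite h, h'; tauto.
- destruct (union_ex D) as [U [hU h]]; exists U; split; [exact hU|].
  intro z; rewrite h; split.
  + intros [s [hs hz]]; apply hD in hs; destruct hs as [x [hx [_ hs]]].
    apply hs in hz; destruct hz as [y [hy ->]]; exists x, y; tauto.
  + intros [x [y [hx [hy ->]]]].
    destruct (repl (A := B) (R := fun y z => z = pr x y)) as [s [hs h']];
      [def|intros; subst; trivial|].
    exists s; rewrite hD, h'; split; [exists x|exists y]; tauto.
Qed.

(** * Equipotence *)

(** Only the elements that truly belong to [A] and [B] count. *)
Definition eqp A B := exists f,
  (forall x, x ∊ A -> exists y, y ∊ B /\ pr x y ∊ f) /\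
  (forall y, y ∊ B -> exists x, x ∊ A /\ pr x y ∊ f) /\
  (forall x y z, pr x y ∊ f -> pr x z ∊ f -> y = z) /\
  (forall x y z, pr x z ∊ f -> pr y z ∊ f -> x = y).

(** The witness is [R] cut down to the product of [A] and [B], so [R] may hold of pairs outside it
    as well. This allows the bijections below to be written as bare coordinate patterns. *)
Lemma eqp_intro (R : M -> M -> Prop) A B :
  Def (fun e => R (e 0) (e 1)) ->
  (forall x, x ∊ A -> exists y, y ∊ B /\ R x y) ->
  (forall y, y ∊ B -> exists x, x ∊ A /\ R x y) ->
  (forall x y z, R x y -> R x z -> y = z) ->
  (forall x y z, R x z -> R y z -> x = y) -> eqp A B.
Proof.
intros hR h1 h2 h3 h4; destruct (times_ex A B) as [C [_ hC]].
destruct (sep C (P := fun p => exists x y, p = pr x y /\ R x y))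
  as [f [_ hf]]; [def|].
assert (h : forall x y, pr x y ∊ f <-> x ∊ A /\ y ∊ B /\ R x y).
{ intros x y; rewrite hf, hC; split.
  - pairs; tauto.
  - intros [hx [hy h]]; split; exists x, y; tauto. }
exists f; repeat split.
- intros x hx; destruct (h1 x hx) as [y hy]; exists y; rewrite h; tauto.
- intros y hy; destruct (h2 y hy) as [x hx]; exists x; rewrite h; tauto.
- intros x y z; rewrite !h; intros [_ [_ hy]] [_ [_ hz]]; exact (h3 x y z hy hz).
- intros x y z; rewrite !h; intros [_ [_ hx]] [_ [_ hy]]; exact (h4 x y z hx hy).
Qed.

Lemma eqp_incl A B : (forall x, x ∊ A <-> x ∊ B) -> eqp A B.
Proof.
intro h; apply eqp_intro with (R := fun x y => x = y); [def| | | |];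
  try congruence; intros x hx; exists x; rewrite h in *; tauto.
Qed.

Lemma eqp_refl A : eqp A A.
Proof. apply eqp_incl; tauto. Qed.

Lemma eqp_sym A B : eqp A B -> eqp B A.
Proof.
intros [f [h1 [h2 [h3 h4]]]].
apply eqp_intro with (R := fun x y => pr y x ∊ f); [def|auto|auto| |];
  intros x y z; [apply h4|apply h3].
Qed.

Lemma eqp_trans A B C : eqp A B -> eqp B C -> eqp A C.
Proof.
intros [f [h1 [h2 [h3 h4]]]] [g [k1 [k2 [k3 k4]]]].
apply eqp_intro with (R := fun x z => exists y, pr x y ∊ f /\ pr y z ∊ g).
- def.
- intros x hx; destruct (h1 x hx) as [y [hy hxy]].
  destruct (k1 y hy) as [z [hz hyz]]; eauto.
- intros z hz; destruct (k2 z hz) as [y [hy hyz]].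
  destruct (h2 y hy) as [x [hx hxy]]; eauto.
- intros x z z' [y [hxy hyz]] [y' [hxy' hyz']].
  rewrite <- (h3 x y y' hxy hxy') in hyz'; exact (k3 y z z' hyz hyz').
- intros x x' z [y [hxy hyz]] [y' [hxy' hyz']].
  rewrite <- (k4 y y' z hyz hyz') in hxy'; exact (h4 x x' y hxy hxy').
Qed.

Lemma App_pr f x y : tr (App f x y) <-> pr x y ∊ f.
Proof.
unfold App; simpl; split.
- intros [p [hp h]]; apply Pair_pr in hp; subst; exact h.
- intro h; exists (pr x y); split; [apply Pair_pr; trivial|exact h].
Qed.

Lemma Function_pr f A : tr (Function f A) <-> cls f /\
  (forall p, p ∊ f -> exists x y, x ∊ A /\ p = pr x y) /\
  (forall x, x ∊ A -> exists y, pr x y ∊ f /\ forall z, pr x z ∊ f -> z = y).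
Proof.
unfold Function, AllIn, ExIn, Amp.
change (tr (Classical f) /\
  (forall p, p ∊ f -> exists x, x ∊ A /\ exists y, tr (Pair p x y)) /\
  (forall x, x ∊ A -> exists y, tr (App f x y) /\
     forall z, tr (App f x z) -> z = y) <-> cls f /\
  (forall p, p ∊ f -> exists x y, x ∊ A /\ p = pr x y) /\
  (forall x, x ∊ A -> exists y, pr x y ∊ f /\ forall z, pr x z ∊ f -> z = y)).
rewrite Classical_cls; split; intros [h1 [h2 h3]];
  (split; [exact h1|split; [clear h3|clear h2]]).
- intros p hp; destruct (h2 p hp) as [x [hx [y h]]]; apply Pair_pr in h.
  exists x, y; tauto.
- intros x hx; destruct (h3 x hx) as [y [h h']]; exists y.
  apply App_pr in h; split; [exact h|]; intros z hz; apply h', App_pr, hz.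
- intros p hp; destruct (h2 p hp) as [x [y [hx h]]]; apply Pair_pr in h.
  exists x; split; [exact hx|exists y; exact h].
- intros x hx; destruct (h3 x hx) as [y [h h']]; exists y.
  apply App_pr in h; split; [exact h|]; intros z hz; apply h', App_pr, hz.
Qed.

(** A witness of [eqp] may be non-classical and contain elements other than pairs from [A] and [B];
    trimming it to the product gives a genuine classical bijection. *)
Lemma Equipotent_eqp A B : tr (Equipotent A B) <-> eqp A B.
Proof.
unfold Equipotent, Bijection, AllIn, ExIn, Amp.
change ((exists f, tr (Function f A) /\
   (forall x y, tr (App f x y) -> y ∊ B) /\
   (forall y, y ∊ B -> exists x, tr (App f x y) /\
     forall z, tr (App f z y) -> z = x)) <-> eqp A B).
split.
- intros [f [hf [h1 h2]]]; apply Function_pr in hf; destruct hf as [_ [h3 h4]].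
  assert (hA : forall x y, pr x y ∊ f -> x ∊ A).
  { intros x y h; destruct (h3 _ h); pairs. }
  assert (hB : forall x y, pr x y ∊ f -> y ∊ B).
  { intros x y h; apply (h1 x), App_pr, h. }
  exists f; repeat split.
  + intros x hx; destruct (h4 x hx) as [y [h _]]; exists y; eauto.
  + intros y hy; destruct (h2 y hy) as [x [h _]]; apply App_pr in h.
    exists x; eauto.
  + intros x y z hy hz; destruct (h4 x) as [y' [_ h]]; [eauto|].
    rewrite (h y), (h z); trivial.
  + intros x y z hx hy; destruct (h2 z) as [x' [_ h]]; [eauto|].
    rewrite (h x), (h y); trivial; apply App_pr; trivial.
- intros [f [h1 [h2 [h3 h4]]]]; destruct (times_ex A B) as [C [_ hC]].
  destruct (sep C (P := fun p => p ∊ f)) as [g [hg hgf]]; [def|].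
  assert (h : forall x y, pr x y ∊ g <-> x ∊ A /\ y ∊ B /\ pr x y ∊ f).
  { intros x y; rewrite hgf, hC; split; [pairs; tauto|].
    intros [hx [hy h]]; split; [exists x, y|]; tauto. }
  exists g; rewrite Function_pr; split; [split; [exact hg|split]|split].
  + intros p hp; apply hgf in hp; destruct hp as [hp _]; apply hC in hp.
    destruct hp as [x [y hp]]; exists x, y; tauto.
  + intros x hx; destruct (h1 x hx) as [y hy]; exists y; split.
    * apply h; tauto.
    * intros z hz; apply h in hz; apply (h3 x); tauto.
  + intros x y hxy; apply App_pr, h in hxy; tauto.
  + intros y hy; destruct (h2 y hy) as [x hx]; exists x; split.
    * apply App_pr, h; tauto.
    * intros z hz; apply App_pr, h in hz; apply (h4 z x y); tauto.
Qed.

(** * The semiring of classical cardinals *)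

(** Defined for all sets, not only classical ones, through their true elements, so that the
    operations are total on the domain as [ring] requires. *)
Definition is_csum A B C := cls C /\ forall z,
  z ∊ C <-> (exists x, x ∊ A /\ z = pr x zero) \/
            (exists x, x ∊ B /\ z = pr x one).
Definition csum A B := epsilon (dom_inhabited M) (is_csum A B).

Definition is_cprod A B C := cls C /\ forall z,
  z ∊ C <-> exists x y, x ∊ A /\ y ∊ B /\ z = pr x y.
Definition cprod A B := epsilon (dom_inhabited M) (is_cprod A B).

Lemma csum_spec A B : is_csum A B (csum A B).
Proof.
refine (epsilon_spec (dom_inhabited M) (is_csum A B) _).
destruct (repl (A := A) (R := fun x z => z = pr x zero)) as [C [_ hC]];
  [def|congruence|].
destruct (repl (A := B) (R := fun x z => z = pr x one)) as [D [_ hD]];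
  [def|congruence|].
destruct (cup_ex C D) as [E [hE h]]; exists E; split; [exact hE|].
intro z; rewrite h, hC, hD; tauto.
Qed.

Lemma cprod_spec A B : is_cprod A B (cprod A B).
Proof. exact (epsilon_spec (dom_inhabited M) _ (times_ex A B)). Qed.

Lemma in_csum A B z : z ∊ csum A B <->
  (exists x, x ∊ A /\ z = pr x zero) \/ (exists x, x ∊ B /\ z = pr x one).
Proof. apply csum_spec. Qed.

Lemma in_cprod A B z :
  z ∊ cprod A B <-> exists x y, x ∊ A /\ y ∊ B /\ z = pr x y.
Proof. apply cprod_spec. Qed.

Lemma pr_in_cprod A B x y : x ∊ A -> y ∊ B -> pr x y ∊ cprod A B.
Proof. intros; apply in_cprod; exists x, y; tauto. Qed.

Lemma in_one x : x ∊ one <-> x = zero.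
Proof. apply one_spec. Qed.

Ltac elements :=
  repeat match goal with
  | H : _ ∊ csum _ _ |- _ => apply in_csum in H
  | H : _ ∊ cprod _ _ |- _ => apply in_cprod in H
  | H : _ ∊ one |- _ => apply in_one in H
  | _ => progress pairs
  end.

Ltac member :=
  repeat first
  [ eassumption
  | match goal with
    | |- _ ∊ one => apply in_one; reflexivity
    | |- _ ∊ csum _ _ => apply in_csum
    | |- pr _ _ ∊ cprod _ _ => apply pr_in_cprod
    | |- (exists _, _ /\ pr _ zero = _) \/ _ => left
    | |- (exists _, _ /\ pr _ _ = _) \/ _ => right
    | |- exists _, _ => eexists
    | |- _ /\ _ => split; [|try reflexivity]
    end ].

Ltac witness := eexists; split; [|solve [eauto 20]]; solve [member].

(** Turns a disjoint union inside a given set into the tagged sum; this is how [A^!] and [A^?]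
    acquire their cardinalities from the parts. *)
Lemma eqp_split A B C :
  (forall x, x ∊ C <-> x ∊ A \/ x ∊ B) -> (forall x, x ∊ A -> ~ x ∊ B) ->
  eqp C (csum A B).
Proof.
intros hC hAB; apply eqp_intro with
  (R := fun x z => x ∊ A /\ z = pr x zero \/ x ∊ B /\ z = pr x one).
- def.
- intros x hx; apply hC in hx; destruct hx; witness.
- intros; elements; eexists; rewrite hC; eauto.
- pairs; exfalso; eapply hAB; eassumption.
- pairs.
Qed.

Lemma csum_eqp A A' B B' :
  eqp A A' -> eqp B B' -> eqp (csum A B) (csum A' B').
Proof.
intros [f [f1 [f2 [f3 f4]]]] [g [g1 [g2 [g3 g4]]]]; apply eqp_intro with
  (R := fun z w =>
    (exists x y, z = pr x zero /\ w = pr y zero /\ pr x y ∊ f) \/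
    (exists x y, z = pr x one /\ w = pr y one /\ pr x y ∊ g)).
- def.
- intros; elements;
    [destruct (f1 x0) as [y [hy h]]|destruct (g1 x0) as [y [hy h]]];
    trivial; witness.
- intros; elements;
    [destruct (f2 x) as [y [hy h]]|destruct (g2 x) as [y [hy h]]];
    trivial; witness.
- pairs; f_equal; eauto.
- pairs; f_equal; eauto.
Qed.

Lemma cprod_eqp A A' B B' :
  eqp A A' -> eqp B B' -> eqp (cprod A B) (cprod A' B').
Proof.
intros [f [f1 [f2 [f3 f4]]]] [g [g1 [g2 [g3 g4]]]]; apply eqp_intro with
  (R := fun z w => exists x y x' y',
    z = pr x y /\ w = pr x' y' /\ pr x x' ∊ f /\ pr y y' ∊ g).
- def.
- intros; elements; destruct (f1 x0) as [x' [hx hx']]; trivial.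
  destruct (g1 x1) as [y' [hy hy']]; trivial.
  exists (pr x' y'); split; [member|eauto 10].
- intros; elements; destruct (f2 x) as [x' [hx hx']]; trivial.
  destruct (g2 x0) as [y' [hy hy']]; trivial.
  exists (pr x' y'); split; [member|eauto 10].
- pairs; f_equal; eauto.
- pairs; f_equal; eauto.
Qed.

Lemma csum_zero_l A : eqp (csum zero A) A.
Proof.
apply eqp_intro with (R := fun z w => z = pr w one); [def| | | |];
  intros; elements; eexists; split; try eassumption; trivial; member.
Qed.

Lemma csum_comm A B : eqp (csum A B) (csum B A).
Proof.
apply eqp_intro with (R := fun z w => exists x,
  z = pr x zero /\ w = pr x one \/ z = pr x one /\ w = pr x zero);
  [def| | | |]; intros; elements; witness.
Qed.

Lemma csum_assoc A B C : eqp (csum A (csum B C)) (csum (csum A B) C).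
Proof.
apply eqp_intro with (R := fun z w => exists x,
  z = pr x zero /\ w = pr (pr x zero) zero \/
  z = pr (pr x zero) one /\ w = pr (pr x one) zero \/
  z = pr (pr x one) one /\ w = pr x one); [def| | | |];
  intros; elements; witness.
Qed.

Lemma cprod_one_l A : eqp (cprod one A) A.
Proof.
apply eqp_intro with (R := fun z w => z = pr zero w); [def| | | |];
  intros; elements; eexists; split; try eassumption; trivial; member.
Qed.

Lemma cprod_zero_l A : eqp (cprod zero A) zero.
Proof. apply eqp_incl; split; intros; elements. Qed.

Lemma cprod_comm A B : eqp (cprod A B) (cprod B A).
Proof.
apply eqp_intro with (R := fun z w => exists x y, z = pr x y /\ w = pr y x);
  [def| | | |]; intros; elements; witness.
Qed.

Lemma cprod_assoc A B C : eqp (cprod A (cprod B C)) (cprod (cprod A B) C).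
Proof.
apply eqp_intro with (R := fun u v => exists x y z,
  u = pr x (pr y z) /\ v = pr (pr x y) z); [def| | | |];
  intros; elements; witness.
Qed.

Lemma cprod_csum_l A B C :
  eqp (cprod (csum A B) C) (csum (cprod A C) (cprod B C)).
Proof.
(* The variable [z] is the tag, moved from the first component to the outside. *)
apply eqp_intro with (R := fun u v => exists x y z,
  u = pr (pr x z) y /\ v = pr (pr x y) z); [def| | | |];
  intros; elements; witness.
Qed.

Lemma eqp_equivalence : Equivalence eqp.
Proof.
exact (Build_Equivalence eqp eqp_refl eqp_sym eqp_trans).
Qed.

Lemma eqp_semiring : semi_ring_theory zero one csum cprod eqp.
Proof.
split.
- exact csum_zero_l.
- exact csum_comm.
- exact csum_assoc.
- exact cprod_one_l.
- exact cprod_zero_l.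
- exact cprod_comm.
- exact cprod_assoc.
- exact cprod_csum_l.
Qed.

Lemma eqp_semiring_ext : sring_eq_ext csum cprod eqp.
Proof.
split; intros x x' hx y y' hy; [apply csum_eqp|apply cprod_eqp]; assumption.
Qed.

Add Ring cardinals : eqp_semiring (setoid eqp_equivalence eqp_semiring_ext).

(** * Ordinals *)

Definition transitive A := forall x y, x ∊ A -> y ∊ x -> y ∊ A.

(** Because of Foundation, this is equivalent to [Ordinal]. *)
Definition ord A :=
  cls A /\ transitive A /\ forall x, x ∊ A -> cls x /\ transitive x.

Lemma ord_in A x : ord A -> x ∊ A -> ord x.
Proof.
intros [_ [h h']] hx; destruct (h' x hx); split; [|split]; trivial.
intros y hy; apply h'; exact (h x y hx hy).
Qed.

Lemma foundation_class A (P : M -> Prop) : Def (fun e => P (e 0)) ->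
  (exists x, x ∊ A /\ P x) ->
  exists x, x ∊ A /\ P x /\ forall y, y ∊ A -> P y -> ~ y ∊ x.
Proof.
intros hP [x hx]; destruct (sep A hP) as [B [_ hB]].
destruct (@foundation B) as [y [hy h]]; [exists x; apply hB, hx|].
exists y; apply hB in hy; split; [tauto|split; [tauto|]].
intros z hz hz'; apply h, hB; tauto.
Qed.

(** Membership induction: Foundation gives a minimal counterexample in [A], and transitivity keeps
    its elements in [A]. *)
Lemma transitive_ind A (P : M -> Prop) : Def (fun e => P (e 0)) ->
  transitive A -> (forall x, x ∊ A -> (forall y, y ∊ x -> P y) -> P x) ->
  forall x, x ∊ A -> P x.
Proof.
intros hP hA h x hx; apply NNPP; intro hx'.
destruct (foundation_class (A := A) (P := fun x => ~ P x)) as [y [hy [hy' h']]];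
  [def|exists x; tauto|].
apply hy', h; [exact hy|]; intros z hz; apply NNPP; intro hz'.
exact (h' z (hA y z hy hz) hz' hz).
Qed.

Lemma succ_ex A : exists B, cls B /\ forall x, x ∊ B <-> x ∊ A \/ x = A.
Proof.
destruct (upair_ex A A) as [s [_ hs]]; destruct (cup_ex A s) as [B [hB h]].
exists B; split; [exact hB|]; intro x; rewrite h, hs; tauto.
Qed.

Lemma ord_succ A B :
  ord A -> cls B -> (forall x, x ∊ B <-> x ∊ A \/ x = A) -> ord B.
Proof.
intros [h1 [h2 h3]] hB h; split; [exact hB|]; split.
- intros x y hx hy; apply h in hx; apply h; left.
  destruct hx as [hx | ->]; [exact (h2 x y hx hy)|exact hy].
- intros x hx; apply h in hx; destruct hx as [hx | ->]; auto.
Qed.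

(** Take a minimal [a] incomparable with some element of the successor of [B], then a minimal such
    [b] for this [a]. By minimality their elements are comparable with the other side, which forces
    [a] and [b] to have the same elements. Passing to successors makes [A] and [B] themselves
    candidates. *)
Lemma ord_trichotomy A B : ord A -> ord B -> A ∊ B \/ A = B \/ B ∊ A.
Proof.
intros hA hB; apply NNPP; intro hAB.
destruct (succ_ex A) as [A' [cA' hA']]; destruct (succ_ex B) as [B' [cB' hB']].
pose proof (ord_succ hA cA' hA') as oA; pose proof (ord_succ hB cB' hB') as oB.
destruct (foundation_class (A := A')
  (P := fun a => exists b, b ∊ B' /\ ~ (a ∊ b \/ a = b \/ b ∊ a)))
  as [a [ha [[b0 hb0] hmin]]]; [def| |].
{ exists A; split; [apply hA'; tauto|]; exists B; split; [apply hB'|]; tauto. }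
destruct (foundation_class (A := B')
  (P := fun b => ~ (a ∊ b \/ a = b \/ b ∊ a)))
  as [b [hb [hab hmin']]]; [def|exists b0; exact hb0|].
destruct (ord_in oA ha) as [ca [ta _]]; destruct (ord_in oB hb) as [cb [tb _]].
apply hab; right; left; apply cls_ext; trivial; intro c; split; intro hc.
- assert (h : c ∊ b \/ c = b \/ b ∊ c).
  { apply NNPP; intro h; apply (hmin c); trivial; [|exists b; tauto].
    exact (proj1 (proj2 oA) a c ha hc). }
  destruct h as [h|[->|h]]; [exact h|tauto|].
  destruct hab; right; right; exact (ta c b hc h).
- assert (h : a ∊ c \/ a = c \/ c ∊ a).
  { apply NNPP; intro h; apply (hmin' c); trivial.
    exact (proj1 (proj2 oB) b c hb hc). }
  destruct h as [h|[<-|h]]; [|tauto|exact h].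
  destruct hab; left; exact (tb c a hc h).
Qed.

(** From left to right, transitivity of membership on the ordinal makes its elements transitive
    sets. Conversely, Foundation supplies irreflexivity and least elements, and [ord_trichotomy]
    supplies linearity. *)
Lemma Ordinal_ord A : tr (Ordinal A) <-> ord A.
Proof.
unfold Ordinal, AllIn, ExIn, Amp, Sub; change (
  tr (Classical A) /\ (forall x, x ∊ A -> tr (Classical x)) /\
  (forall x, x ∊ A -> forall y, y ∊ x -> y ∊ A) /\
  (forall x, x ∊ A -> ~ x ∊ x) /\
  (forall x, x ∊ A -> forall y, y ∊ A -> forall z, z ∊ A ->
     x ∊ y -> y ∊ z -> x ∊ z) /\
  (forall x, x ∊ A -> forall y, y ∊ A -> x ∊ y \/ x = y \/ y ∊ x) /\
  (forall B, tr (Classical B) /\ tr (Sub (ext B) (ext A)) /\ (exists x, x ∊ B) ->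
     exists x, x ∊ B /\ forall y, y ∊ B -> ~ y ∊ x) <-> ord A).
rewrite Classical_cls; split.
- intros [h1 [h2 [h3 [_ [h4 _]]]]]; split; [exact h1|split].
  + intros x y hx; exact (h3 x hx y).
  + intros x hx; split; [apply Classical_cls, h2, hx|].
    intros y z hy hz; assert (hy' := h3 x hx y hy).
    exact (h4 z (h3 y hy' z hz) y hy' x hx hz hy).
- intros hA; pose proof hA as [h1 [h2 h3]].
  split; [exact h1|split; [|split; [|split; [|split; [|split]]]]].
  + intros x hx; apply Classical_cls, h3, hx.
  + intros x hx y; exact (h2 x y hx).
  + intros x _; apply mem_irrefl.
  + intros x _ y _ z hz hxy hyz; destruct (h3 z hz) as [_ h].
    exact (h y x hyz hxy).
  + intros x hx y hy; exact (ord_trichotomy (ord_in hA hx) (ord_in hA hy)).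
  + intros B [_ [_ h]]; exact (foundation h).
Qed.

Lemma ord_least (P : M -> Prop) A : Def (fun e => P (e 0)) -> ord A -> P A ->
  exists B, ord B /\ P B /\ forall C, ord C -> P C -> B = C \/ B ∊ C.
Proof.
intros hP hA pA; destruct (succ_ex A) as [A' [cA' hA']].
destruct (foundation_class (A := A') hP) as [B [hB [pB h]]].
{ exists A; split; [apply hA'; tauto|exact pA]. }
pose proof (ord_in (ord_succ hA cA' hA') hB) as oB.
exists B; split; [exact oB|split; [exact pB|]]; intros C hC pC.
destruct (ord_trichotomy oB hC) as [h'|[h'|h']]; [tauto|tauto|].
destruct (h C); trivial.
exact (proj1 (proj2 (ord_succ hA cA' hA')) B C hB h').
Qed.

(** * The well-ordering theorem *)

Section WellOrdering.
Variables X g : M.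
Hypothesis g_ex : forall Y y, cls Y -> (forall x, x ∊ Y -> x ∊ X) -> y ∊ Y ->
  exists x, pr Y x ∊ g.
Hypothesis g_in : forall Y x, pr Y x ∊ g -> x ∊ Y.
Hypothesis g_fun : forall Y x y, pr Y x ∊ g -> pr Y y ∊ g -> x = y.

(** What remains of [X] once the values of [f] below [a] have been removed. It is kept as a relation
    so that [def] can unfold it into a formula. *)
Definition rest f a Y := cls Y /\
  forall x, x ∊ Y <-> x ∊ X /\ ~ exists b, b ∊ a /\ pr b x ∊ f.

(** [f] satisfies [f a = g (X \ f[a])] on the ordinal [A]. *)
Definition attempt A f := ord A /\ forall a, a ∊ A ->
  exists x Y, rest f a Y /\ pr Y x ∊ g /\ pr a x ∊ f /\
    forall y, pr a y ∊ f -> y = x.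

(** The union of all attempts: transfinite recursion as a definable relation, which is not yet known
    to be a set. An attempt is constrained only at indices in [A], hence the clause [a ∊ A]. *)
Definition enum a x := exists A f, attempt A f /\ a ∊ A /\ pr a x ∊ f.

Lemma def_enum : Def (fun e => enum (e 0) (e 1)).
Proof. unfold enum, attempt, rest, ord, transitive, cls; def. Qed.

Lemma rest_ext f f' a Y :
  (forall b x, b ∊ a -> (pr b x ∊ f <-> pr b x ∊ f')) ->
  rest f a Y -> rest f' a Y.
Proof.
intros h [hY h']; split; [exact hY|]; intro x; rewrite h'.
split; intros [hx hx']; (split; [exact hx|]); intros [b hb]; apply hx';
  exists b; specialize (h b x); tauto.
Qed.

Lemma rest_unique f a Y Y' : rest f a Y -> rest f a Y' -> Y = Y'.
Proof.
intros [hY h] [hY' h']; apply cls_ext; trivial; intro x; rewrite h, h'; tauto.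
Qed.

(** By induction on [a]: agreement below [a] gives the same remainder, and [g] picks the same
    element from it. *)
Lemma attempt_agree A f B f' : attempt A f -> attempt B f' ->
  forall a, a ∊ A -> a ∊ B -> forall x, pr a x ∊ f <-> pr a x ∊ f'.
Proof.
intros [hA hf] [hB hf'].
apply (transitive_ind (A := A) (P := fun a => a ∊ B ->
  forall x, pr a x ∊ f <-> pr a x ∊ f')); [def|exact (proj1 (proj2 hA))|].
intros a ha IH ha'.
destruct (hf a ha) as [x [Y [hY [hYx [hx hx']]]]].
destruct (hf' a ha') as [y [Z [hZ [hZy [hy hy']]]]].
assert (hY' : rest f' a Y).
{ apply rest_ext with f; [|exact hY]; intros b z hb; apply IH; trivial.
  exact (proj1 (proj2 hB) a b ha' hb). }
rewrite (rest_unique hY' hZ) in hYx; pose proof (g_fun hYx hZy); subst y.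
intro z; split; intro hz; [rewrite (hx' z hz)|rewrite (hy' z hz)]; trivial.
Qed.

Lemma attempt_enum A f a x : attempt A f -> a ∊ A -> (enum a x <-> pr a x ∊ f).
Proof.
intros hf ha; split.
- intros [B [f' [hf' [hb h]]]]; exact (proj1 (attempt_agree hf' hf hb ha x) h).
- intro h; exists A, f; tauto.
Qed.

Lemma enum_in a x : enum a x -> x ∊ X.
Proof.
intros [A [f [[_ h] [ha hx]]]].
destruct (h a ha) as [y [Y [[_ hY] [hYy [_ h']]]]]; rewrite (h' x hx).
apply hY, g_in, hYy.
Qed.

Lemma enum_fun a x y : enum a x -> enum a y -> x = y.
Proof.
intros [A [f [h [ha hx]]]] hy; apply (attempt_enum y h ha) in hy.
destruct (proj2 h a ha) as [z [Y [_ [_ [_ h']]]]].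
rewrite (h' x hx), (h' y hy); trivial.
Qed.

(** The value at [b] is picked from what the values at smaller indices have left over. *)
Lemma enum_mem a b x : a ∊ b -> enum a x -> ~ enum b x.
Proof.
intros hab hx [A [f [h [hb hx']]]].
destruct (proj2 h b hb) as [y [Y [[_ hY] [hYy [_ h']]]]].
rewrite (h' x hx') in *; apply g_in, hY in hYy; apply (proj2 hYy).
exists a; split; [exact hab|]; apply (attempt_enum y h); [|exact hx].
exact (proj1 (proj2 (proj1 h)) b a hb hab).
Qed.

Lemma enum_ord a x : enum a x -> ord a.
Proof. intros [A [f [[h _] [ha _]]]]; exact (ord_in h ha). Qed.

Lemma enum_inj a b x : enum a x -> enum b x -> a = b.
Proof.
intros ha hb; pose proof (enum_ord ha) as oa; pose proof (enum_ord hb) as ob.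
destruct (ord_trichotomy oa ob) as [h|[h|h]]; [|exact h|].
- destruct (enum_mem h ha hb).
- destruct (enum_mem h hb ha).
Qed.

(** Injectivity bounds the length of the recursion: indices are determined by elements of [X], so
    Replacement along the inverse of [enum] collects them in a set [D]. This makes the whole
    enumeration itself an attempt. *)
Lemma enum_domain : exists D f, attempt D f /\
  (forall a x, pr a x ∊ f <-> enum a x) /\
  (forall a x, enum a x -> a ∊ D).
Proof.
pose proof def_enum as hd.
destruct (repl (A := X) (R := fun x a => enum a x)) as [D [cD hD]];
  [def|intros x a b _; apply enum_inj|].
destruct (times_ex D X) as [C [_ hC]].
destruct (sep C (P := fun p => exists a x, p = pr a x /\ enum a x))
  as [f [_ hf]]; [def|].
assert (hDx : forall a x, enum a x -> a ∊ D).
{ intros a x h; apply hD; exists x; split; [exact (enum_in h)|exact h]. }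
assert (hfx : forall a x, pr a x ∊ f <-> enum a x).
{ intros a x; rewrite hf, hC; split; [pairs|]; intro h; split; exists a, x;
    pose proof (hDx a x h); pose proof (enum_in h); tauto. }
exists D, f; split; [split|split; [exact hfx|exact hDx]].
- split; [exact cD|split].
  + intros a b ha hb; apply hD in ha; destruct ha as [x [_ [A [k [h [ha _]]]]]].
    assert (hb' : b ∊ A) by exact (proj1 (proj2 (proj1 h)) a b ha hb).
    destruct (proj2 h b hb') as [y [_ [_ [_ [hy _]]]]]; apply (hDx b y).
    exists A, k; tauto.
  + intros a ha; apply hD in ha; destruct ha as [x [_ h]].
    destruct (enum_ord h) as [h1 [h2 _]]; tauto.
- intros a ha; apply hD in ha; destruct ha as [x [_ h]].
  pose proof h as [A [k [hk [ha hx]]]].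
  destruct (proj2 hk a ha) as [x' [Y [hY [hYx [hx' hu]]]]].
  exists x', Y; rewrite hfx.
  split; [|split; [exact hYx|split; [exists A, k; tauto|]]].
  + apply rest_ext with k; [|exact hY]; intros b y hb; rewrite hfx.
    symmetry; apply (attempt_enum y hk).
    exact (proj1 (proj2 (proj1 hk)) a b ha hb).
  + intros y hy; apply hu; apply hfx, (attempt_enum y hk ha) in hy; exact hy.
Qed.

(** Otherwise the enumeration could be extended to the ordinal of all its
    indices, which would then belong to itself. *)
Lemma enum_surj x : x ∊ X -> exists a, enum a x.
Proof.
intro hx; apply NNPP; intro hx'.
destruct enum_domain as [D [f [hf [hfe hD]]]].
(* The elements never enumerated; [x] is one of them, so [g] provides some [y] from [Y]. Below, [k]
   extends [f] by the value [y] at the new index [D]. *)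
destruct (sep X (P := fun x => ~ exists b, b ∊ D /\ pr b x ∊ f)) as [Y hY];
  [def|].
destruct (g_ex (Y := Y) (y := x)) as [y hy].
{ apply hY. } { intros z hz; apply hY in hz; tauto. }
{ apply hY; split; [exact hx|]; intros [b [_ hb]]; apply hx'; exists b.
  apply hfe, hb. }
destruct (succ_ex D) as [E [cE hE]].
destruct (upair_ex (pr D y) (pr D y)) as [s [_ hs]].
destruct (cup_ex f s) as [k [_ hk]].
assert (hkf : forall b z, b ∊ D -> (pr b z ∊ f <-> pr b z ∊ k)).
{ intros b z hb; rewrite hk, hs; split; [tauto|].
  assert (b <> D) by (intros ->; exact (mem_irrefl hb)).
  pairs; tauto. }
assert (hkD : forall z, pr D z ∊ k <-> z = y).
{ intro z; rewrite hk, hs; split; [|intros ->; tauto].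
  intros [hz|hz]; [|pairs].
  apply hfe, hD in hz; destruct (mem_irrefl hz). }
assert (hkE : attempt E k).
{ split; [exact (ord_succ (proj1 hf) cE hE)|]; intros a ha; apply hE in ha.
  destruct ha as [ha | ->].
  - destruct (proj2 hf a ha) as [z [Z [hZ [hZz [hz hz']]]]]; exists z, Z.
    split; [|split; [exact hZz|split; [apply hkf; assumption|]]].
    + apply rest_ext with f; [|exact hZ]; intros b w hb; apply hkf.
      exact (proj1 (proj2 (proj1 hf)) a b ha hb).
    + intros w hw; apply hz', hkf; assumption.
  - exists y, Y; split; [|split; [exact hy|split; [apply hkD; trivial|]]].
    + apply rest_ext with f; [|exact hY]; intros b w hb; apply hkf, hb.
    + intros w hw; apply hkD, hw. }
apply (@mem_irrefl D), (hD D y); exists E, k; split; [exact hkE|].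
split; [apply hE|apply hkD]; tauto.
Qed.

Lemma enum_eqp : exists A, ord A /\ eqp X A.
Proof.
destruct enum_domain as [D [f [hf [hfe hD]]]].
exists D; split; [exact (proj1 hf)|].
pose proof def_enum as hd.
apply eqp_intro with (R := fun x a => enum a x); [def| | | |].
- intros x hx; destruct (enum_surj hx) as [a ha]; exists a.
  split; [exact (hD a x ha)|exact ha].
- intros a ha; destruct (proj2 hf a ha) as [x [_ [_ [_ [hx _]]]]].
  apply hfe in hx; exists x; split; [exact (enum_in hx)|exact hx].
- intros x a b; apply enum_inj.
- intros x y a; apply enum_fun.
Qed.

End WellOrdering.

Lemma choice_ex X : exists g,
  (forall Y y, cls Y -> (forall x, x ∊ Y -> x ∊ X) -> y ∊ Y ->
     exists x, pr Y x ∊ g) /\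
  (forall Y x, pr Y x ∊ g -> x ∊ Y) /\
  (forall Y x y, pr Y x ∊ g -> pr Y y ∊ g -> x = y).
Proof.
(* [X] is replaced by its true elements because [power_ex] speaks of classical sets. *)
destruct (sep X (P := fun _ => True)) as [X' [cX hX]]; [def|].
destruct (power_ex X') as [P hP].
destruct (sep P (P := fun Y => exists y, y ∊ Y)) as [C [cC hC]]; [def|].
assert (h : exists g, tr (Function g C) /\
              forall x y, tr (App g x y) -> y ∊ x).
{ apply (hM BZFC_choice C); split; [apply Classical_cls, cC|].
  intros Y hY; apply hC in hY; apply hY. }
destruct h as [g [hg hg']]; apply Function_pr in hg; destruct hg as [_ [h1 h2]].
exists g; split; [|split].
- intros Y y hY hYX hy; destruct (h2 Y) as [x [hx _]]; [|exists x; exact hx].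
  apply hC; split; [|exists y; exact hy].
  apply hP; trivial; intros z hz; apply hX; split; auto.
- intros Y x hx; apply hg', App_pr, hx.
- intros Y x y hx hy; destruct (h2 Y) as [z [_ h]].
  + destruct (h1 _ hx) as [Z [z [hZ h]]]; pairs.
  + rewrite (h x hx), (h y hy); trivial.
Qed.

Lemma ord_eqp X : exists A, ord A /\ eqp X A.
Proof. destruct (choice_ex X) as [g [h1 [h2 h3]]]; exact (enum_eqp h1 h2 h3). Qed.

(** * Cardinal numbers *)

Definition clcard A o :=
  ord o /\ eqp A o /\ forall p, ord p -> eqp A p -> o = p \/ o ∊ p.

Lemma clcard_ex A : exists o, clcard A o.
Proof.
destruct (ord_eqp A) as [o [ho h]].
apply ord_least with (A := o) (P := fun p => eqp A p); trivial.
unfold eqp; def.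
Qed.

Lemma clcard_unique A B o p : clcard A o -> clcard B p -> eqp A B -> o = p.
Proof.
intros [ho [hA hmin]] [hp [hB hmin']] h.
destruct (hmin p hp (eqp_trans h hB)) as [h1|h1]; [exact h1|].
destruct (hmin' o ho (eqp_trans (eqp_sym h) hA)) as [h2|h2]; [auto|].
destruct ho as [_ [ho _]]; destruct (mem_irrefl (x := p)).
destruct hp as [_ [hp _]]; exact (hp o p h1 h2).
Qed.

Lemma clcard_eqp A B o : clcard A o -> clcard B o -> eqp A B.
Proof. intros [_ [hA _]] [_ [hB _]]; exact (eqp_trans hA (eqp_sym hB)). Qed.

Lemma clcard_ext A B o : eqp A B -> clcard A o -> clcard B o.
Proof.
intros h [ho [hA hmin]]; split; [exact ho|split].
- exact (eqp_trans (eqp_sym h) hA).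
- intros p hp hB; apply hmin; [exact hp|exact (eqp_trans h hB)].
Qed.

(** [A] only has to have the right true elements and need not be the value of the class term, since
    [clcard] is invariant under [eqp]. *)
Lemma ClCard_clcard (X : class M) A o : (forall x, fa (X x) <-> ~ tr (X x)) ->
  (forall x, x ∊ A <-> tr (X x)) -> tr (ClCard X o) <-> clcard A o.
Proof.
intros hX hA; change (tr (ClCard X o)) with (exists B, tr (IsSet B X) /\
  tr (Ordinal o) /\ tr (Equipotent B o) /\
  forall p, tr (Ordinal p) /\ tr (Equipotent B p) -> o = p \/ o ∊ p).
split.
- intros [B [hB [ho [hBo hmin]]]].
  apply IsSet_cls in hB; [|exact hX]; destruct hB as [_ hB].
  apply clcard_ext with B; [apply eqp_incl; intro x; rewrite hA; apply hB|].
  split; [apply Ordinal_ord, ho|split; [apply Equipotent_eqp, hBo|]].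
  intros p hp h; apply hmin; split; [apply Ordinal_ord|apply Equipotent_eqp];
    assumption.
- intro h; destruct (sep A (P := fun _ => True)) as [B [cB hB]]; [def|].
  assert (hAB : eqp A B) by (apply eqp_incl; intro x; rewrite hB; tauto).
  destruct (clcard_ext hAB h) as [ho [hBo hmin]]; exists B; split; [|split; [|split]].
  + apply IsSet_cls; [exact hX|split; [exact cB|]].
    intro x; rewrite hB, hA; tauto.
  + apply Ordinal_ord, ho.
  + apply Equipotent_eqp, hBo.
  + intros p [hp h']; apply Ordinal_ord in hp; apply Equipotent_eqp in h'; auto.
Qed.

Definition bracket A X Y := forall x,
  (x ∊ A <-> x ∊ X) /\ (mem_neg x A <-> ~ x ∊ Y).

Lemma bracket_unique A B X Y : bracket A X Y -> bracket B X Y -> A = B.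
Proof.
intros h h'; apply set_ext; intro x; specialize (h x); specialize (h' x); tauto.
Qed.

Lemma bracket_inj A X Y X' Y' : cls X -> cls Y -> cls X' -> cls Y' ->
  bracket A X Y -> bracket A X' Y' -> X = X' /\ Y = Y'.
Proof.
intros hX hY hX' hY' h h'; split; apply cls_ext; trivial; intro x;
  specialize (h x); specialize (h' x).
- tauto.
- split; intro hx; apply NNPP; tauto.
Qed.

Lemma Bracket2_bracket A X Y : cls X -> cls Y ->
  tr (Bracket2 A (ext X) (ext Y)) <-> bracket A X Y.
Proof.
intros hX hY; unfold Bracket2, bracket; simpl; split.
- intros [h h'] x; specialize (h x); specialize (h' x); specialize (hX x).
  specialize (hY x); split; [tauto|].
  split; [tauto|intro hx; apply NNPP; tauto].
- intro h; split; intro x; specialize (h x); specialize (hX x);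
    specialize (hY x); [tauto|].
  assert (h' : (mem_neg x A -> False) <-> x ∊ Y).
  { split; [intro; apply NNPP|]; tauto. }
  tauto.
Qed.

Lemma Triple_pr k X Y Z : tr (Triple k X Y Z) <-> k = pr (pr X Y) Z.
Proof.
change ((exists q, tr (Pair q X Y) /\ tr (Pair k q Z)) <-> k = pr (pr X Y) Z).
split.
- intros [q [hq hk]]; apply Pair_pr in hq; apply Pair_pr in hk; congruence.
- intros ->; exists (pr X Y); split; apply Pair_pr; trivial.
Qed.

(** [k = |A|] whenever [A_t], [A_b] and [A_n] are equipotent to [T], [B] and
    [N]. *)
Definition cardinal T B N k := exists i q t b n X Y Z,
  clcard (csum T B) i /\ clcard (csum T N) q /\
  clcard T t /\ clcard B b /\ clcard N n /\
  bracket X i q /\ bracket Y t q /\ bracket Z b n /\ k = pr (pr X Y) Z.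

Lemma cardinal_ex T B N : exists k, cardinal T B N k.
Proof.
destruct (clcard_ex (csum T B)) as [i hi], (clcard_ex (csum T N)) as [q hq].
destruct (clcard_ex T) as [t ht], (clcard_ex B) as [b hb], (clcard_ex N) as [n hn].
destruct (bracket_ex i q) as [X hX], (bracket_ex t q) as [Y hY].
destruct (bracket_ex b n) as [Z hZ].
exists (pr (pr X Y) Z), i, q, t, b, n, X, Y, Z; tauto.
Qed.

Lemma cardinal_unique T B N T' B' N' k k' :
  eqp T T' -> eqp B B' -> eqp N N' ->
  cardinal T B N k -> cardinal T' B' N' k' -> k = k'.
Proof.
intros eT eB eN
  [i [q [t [b [n [X [Y [Z [hi [hq [ht [hb [hn [hX [hY [hZ ->]]]]]]]]]]]]]]]]
  [i' [q' [t' [b' [n' [X' [Y' [Z'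
     [hi' [hq' [ht' [hb' [hn' [hX' [hY' [hZ' ->]]]]]]]]]]]]]]]].
rewrite <- (clcard_unique hi hi' (csum_eqp eT eB)) in *.
rewrite <- (clcard_unique hq hq' (csum_eqp eT eN)) in *.
rewrite <- (clcard_unique ht ht' eT), <- (clcard_unique hb hb' eB),
  <- (clcard_unique hn hn' eN) in *.
rewrite (bracket_unique hX hX'), (bracket_unique hY hY'), (bracket_unique hZ hZ').
reflexivity.
Qed.

Lemma cardinal_ext T B N T' B' N' k :
  eqp T T' -> eqp B B' -> eqp N N' -> cardinal T B N k -> cardinal T' B' N' k.
Proof.
intros eT eB eN h; destruct (cardinal_ex T' B' N') as [k' h'].
rewrite (cardinal_unique eT eB eN h h'); exact h'.
Qed.

(** The cardinality of [T] is read off from the truth half of [Y], those of [B] and [N] from the two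
    halves of [Z]. No summand has to be cancelled, which would fail for infinite sets. *)
Lemma cardinal_inj T B N T' B' N' k :
  cardinal T B N k -> cardinal T' B' N' k -> eqp T T' /\ eqp B B' /\ eqp N N'.
Proof.
intros
  [i [q [t [b [n [X [Y [Z [hi [hq [ht [hb [hn [hX [hY [hZ ->]]]]]]]]]]]]]]]]
  [i' [q' [t' [b' [n' [X' [Y' [Z'
     [hi' [hq' [ht' [hb' [hn' [hX' [hY' [hZ' h]]]]]]]]]]]]]]]].
apply pr_inj in h; destruct h as [h <-]; apply pr_inj in h; destruct h as [<- <-].
assert (hc : forall A o, clcard A o -> cls o) by (intros A o [[h _] _]; exact h).
destruct (bracket_inj (hc _ _ ht) (hc _ _ hq) (hc _ _ ht') (hc _ _ hq') hY hY')
  as [<- _].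
destruct (bracket_inj (hc _ _ hb) (hc _ _ hn) (hc _ _ hb') (hc _ _ hn') hZ hZ')
  as [<- <-].
split; [|split]; eapply clcard_eqp; eassumption.
Qed.

Lemma cardinal_fun T B N k k' : cardinal T B N k -> cardinal T B N k' -> k = k'.
Proof. apply cardinal_unique; apply eqp_refl. Qed.

Definition parts A T B N := forall x,
  (x ∊ T <-> x ∊ A /\ ~ mem_neg x A) /\
  (x ∊ B <-> x ∊ A /\ mem_neg x A) /\
  (x ∊ N <-> ~ x ∊ A /\ ~ mem_neg x A).

Lemma parts_ex A : exists T B N, parts A T B N.
Proof.
destruct (superset A) as [C [_ hC]].
destruct (sep C (P := fun x => x ∊ A /\ ~ mem_neg x A)) as [T [_ hT]]; [def|].
destruct (sep C (P := fun x => x ∊ A /\ mem_neg x A)) as [B [_ hB]]; [def|].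
destruct (sep C (P := fun x => ~ x ∊ A /\ ~ mem_neg x A)) as [N [_ hN]]; [def|].
exists T, B, N; intro x; rewrite hT, hB, hN; specialize (hC x); tauto.
Qed.

(** [A^!] is the disjoint union of [T] and [B], and [A^?] that of [T] and [N]; the remaining class
    terms are matched with the parts directly. *)
Lemma Card_cardinal A T B N k :
  parts A T B N -> tr (Card A k) <-> cardinal T B N k.
Proof.
intro h.
change (tr (Card A k)) with (exists i q t b n X Y Z,
  tr (ClCard (inn A) i) /\ tr (ClCard (out A) q) /\ tr (ClCard (part_t A) t) /\
  tr (ClCard (part_b A) b) /\ tr (ClCard (part_n A) n) /\
  tr (Bracket2 X (ext i) (ext q)) /\ tr (Bracket2 Y (ext t) (ext q)) /\
  tr (Bracket2 Z (ext b) (ext n)) /\ tr (Triple k X Y Z)).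
destruct (cup_ex T B) as [I [_ hI]], (cup_ex T N) as [Q [_ hQ]].
assert (eI : eqp I (csum T B)).
{ apply eqp_split; [exact hI|]; intro x; destruct (h x); tauto. }
assert (eQ : eqp Q (csum T N)).
{ apply eqp_split; [exact hQ|]; intro x; destruct (h x); tauto. }
assert (ci : forall o, tr (ClCard (inn A) o) <-> clcard (csum T B) o).
{ intro o; rewrite (@ClCard_clcard (inn A) I).
  - split; apply clcard_ext; [|apply eqp_sym]; exact eI.
  - intro x; simpl; tauto.
  - intro x; rewrite hI; destruct (h x) as [-> [-> _]]; simpl.
    destruct (classic (mem_neg x A)); tauto. }
assert (cq : forall o, tr (ClCard (out A) o) <-> clcard (csum T N) o).
{ intro o; rewrite (@ClCard_clcard (out A) Q).
  - split; apply clcard_ext; [|apply eqp_sym]; exact eQ.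
  - intro x; simpl; destruct (classic (mem_neg x A)); tauto.
  - intro x; rewrite hQ; destruct (h x) as [-> [_ ->]]; simpl.
    destruct (classic (x ∊ A)); tauto. }
assert (ct : forall o, tr (ClCard (part_t A) o) <-> clcard T o).
{ intro o; apply ClCard_clcard; intro x; simpl.
  - destruct (classic (mem_neg x A)), (classic (x ∊ A)); tauto.
  - destruct (h x) as [-> _]; tauto. }
assert (cb : forall o, tr (ClCard (part_b A) o) <-> clcard B o).
{ intro o; apply ClCard_clcard; intro x; simpl.
  - destruct (classic (mem_neg x A)), (classic (x ∊ A)); tauto.
  - destruct (h x) as [_ [-> _]]; tauto. }
assert (cn : forall o, tr (ClCard (part_n A) o) <-> clcard N o).
{ intro o; apply ClCard_clcard; intro x; simpl.
  - destruct (classic (mem_neg x A)), (classic (x ∊ A)); tauto.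
  - destruct (h x) as [_ [_ ->]]; tauto. }
assert (hc : forall A o, clcard A o -> cls o) by (intros ? o [[hc _] _]; exact hc).
split; intros [i [q [t [b [n [X [Y [Z
  [hi [hq [ht [hb [hn [hX [hY [hZ hk]]]]]]]]]]]]]]]];
  exists i, q, t, b, n, X, Y, Z;
  rewrite ci, cq, ct, cb, cn, Triple_pr, !Bracket2_bracket in *; eauto 20.
Qed.

(** * Values of terms *)

(** Working up to equipotence allows [T], [B], [N] to be semiring expressions in [csum] and
    [cprod]. *)
Definition has_parts A T B N :=
  exists T' B' N', parts A T' B' N' /\ eqp T' T /\ eqp B' B /\ eqp N' N.

Lemma Card_has_parts A T B N k :
  has_parts A T B N -> tr (Card A k) <-> cardinal T B N k.
Proof.
intros [T' [B' [N' [h [hT [hB hN]]]]]]; rewrite (Card_cardinal k h).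
split; apply cardinal_ext; trivial; apply eqp_sym; assumption.
Qed.

Lemma has_parts_ex A : exists T B N, has_parts A T B N.
Proof.
destruct (parts_ex A) as [T [B [N h]]]; exists T, B, N, T, B, N.
auto using eqp_refl.
Qed.

Lemma cls_has_parts A : cls A -> has_parts A A zero zero.
Proof.
intro h; exists A, zero, zero; split; [|auto using eqp_refl].
intro x; specialize (h x); pose proof (@in_zero x).
destruct (classic (x ∊ A)); tauto.
Qed.

(** The term denotes the cardinal with components [T], [B], [N]. Carrying a set [A] along ensures
    that sums and products have operands to act on, without building a set from arbitrary
    components. *)
Definition rep (s : term M) T B N :=
  (exists A, has_parts A T B N) /\ forall w, tr (s w) <-> cardinal T B N w.

Lemma rep_intro (s : term M) (P : M -> Prop) T B N :
  (forall w, tr (s w) <-> exists A, P A /\ tr (Card A w)) ->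
  (exists A, P A) -> (forall A, P A -> has_parts A T B N) -> rep s T B N.
Proof.
intros hs [A hA] h; split; [exists A; auto|]; intro w; rewrite hs; split.
- intros [A' [hA' hw]]; apply (Card_has_parts w (h A' hA')), hw.
- intro hw; exists A; split; [exact hA|]; apply (Card_has_parts w (h A hA)), hw.
Qed.

(** Existence and uniqueness of the values are already contained in [rep], so only the comparison of
    components is left. *)
Lemma TEq_rep (s s' : term M) T B N T' B' N' :
  rep s T B N -> rep s' T' B' N' ->
  tr (TEq s s') <-> eqp T T' /\ eqp B B' /\ eqp N N'.
Proof.
intros [_ hs] [_ hs'].
change (tr (TEq s s')) with (exists v,
  (forall w, tr (s w) <-> w = v) /\ (forall w, tr (s' w) <-> w = v)).
split.
- intros [v [h h']]; apply cardinal_inj with v.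
  + apply hs, h; reflexivity.
  + apply hs', h'; reflexivity.
- intros [hT [hB hN]]; destruct (cardinal_ex T B N) as [v hv]; exists v.
  pose proof (cardinal_ext hT hB hN hv) as hv'.
  split; intro w; [rewrite hs|rewrite hs']; (split; [|intros ->; assumption]);
    intro hw; eapply cardinal_fun; eassumption.
Qed.

Lemma rep_TVar k T B N :
  (exists A, has_parts A T B N) -> cardinal T B N k -> rep (TVar k) T B N.
Proof.
intros h hk; split; [exact h|]; intro w; simpl; split; [intros ->; exact hk|].
intro hw; exact (cardinal_fun hw hk).
Qed.

Lemma rep_T0 : rep T0 zero zero zero.
Proof.
apply rep_intro with (fun A => A = zero); [|exists zero; trivial|].
- intro w; change ((exists e, tr (Zero e) /\ tr (Card e w)) <->
    exists A, A = zero /\ tr (Card A w)).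
  split; intros [e [he h]]; exists e; apply Zero_zero in he; auto.
- intros A ->; exact (cls_has_parts zero_cls).
Qed.

Lemma rep_T1 : rep T1 one zero zero.
Proof.
apply rep_intro with (fun A => A = one); [|exists one; trivial|].
- intro w; change ((exists e, tr (One e) /\ tr (Card e w)) <->
    exists A, A = one /\ tr (Card A w)).
  split; intros [e [he h]]; exists e; apply One_one in he; auto.
- intros A ->; exact (cls_has_parts (proj1 one_spec)).
Qed.

(** A set whose only part is the true and false element 0 has [A^!] equal to the ordinal 1 and [A^?]
    empty. For the set defining [Tn] the two are exchanged. *)
Lemma Bracket3_b A e :
  tr (Zero e ∧ Bracket3 A (sing e) (@empty M) (@empty M))%bs4 <->
  e = zero /\ bracket A one zero.
Proof.
change (tr (Zero e) /\
  (forall x, tr (part_b A x ⇔ Bang (x == e))%bs4) /\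
  (forall x, tr (part_t A x ⇔ Bot)%bs4) /\
  (forall x, tr (part_n A x ⇔ Bot)%bs4) <-> e = zero /\ bracket A one zero).
rewrite Zero_zero; split.
- intros [-> [hb [ht hn]]]; split; [trivial|]; intro x; rewrite in_one.
  specialize (hb x); specialize (ht x); specialize (hn x).
  pose proof (@in_zero x); simpl in hb, ht, hn.
  destruct (classic (mem_neg x A)); tauto.
- intros [-> h]; split; [trivial|]; split; [|split]; intro x;
    destruct (h x) as [h1 h2]; pose proof (@in_zero x);
    rewrite in_one in h1; simpl; tauto.
Qed.

Lemma Bracket3_n A e :
  tr (Zero e ∧ Bracket3 A (@empty M) (@empty M) (sing e))%bs4 <->
  e = zero /\ bracket A zero one.
Proof.
change (tr (Zero e) /\
  (forall x, tr (part_b A x ⇔ Bot)%bs4) /\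
  (forall x, tr (part_t A x ⇔ Bot)%bs4) /\
  (forall x, tr (part_n A x ⇔ Bang (x == e))%bs4) <->
  e = zero /\ bracket A zero one).
rewrite Zero_zero; split.
- intros [-> [hb [ht hn]]]; split; [trivial|]; intro x; rewrite in_one.
  specialize (hb x); specialize (ht x); specialize (hn x).
  pose proof (@in_zero x); simpl in hb, ht, hn.
  destruct (classic (mem_neg x A)), (classic (x ∊ A)); tauto.
- intros [-> h]; split; [trivial|]; split; [|split]; intro x;
    destruct (h x) as [h1 h2]; pose proof (@in_zero x);
    rewrite in_one in h2; simpl; destruct (classic (x = zero)); tauto.
Qed.

Lemma rep_Tb : rep Tb zero one zero.
Proof.
apply rep_intro with (fun A => bracket A one zero).
- intro w; change ((exists e A, tr (Zero e) /\
    tr (Bracket3 A (sing e) (@empty M) (@empty M)) /\ tr (Card A w)) <->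
    exists A, bracket A one zero /\ tr (Card A w)).
  split.
  + intros [e [A [h1 [h2 h]]]]; exists A; split; [|exact h].
    apply (proj1 (Bracket3_b A e) (conj h1 h2)).
  + intros [A [hA h]]; exists zero, A.
    destruct (proj2 (Bracket3_b A zero) (conj eq_refl hA)); auto.
- apply bracket_ex.
- intros A h; exists zero, one, zero; split; [|auto using eqp_refl].
  intro x; destruct (h x); pose proof (@in_zero x); tauto.
Qed.

Lemma rep_Tn : rep Tn zero zero one.
Proof.
apply rep_intro with (fun A => bracket A zero one).
- intro w; change ((exists e A, tr (Zero e) /\
    tr (Bracket3 A (@empty M) (@empty M) (sing e)) /\ tr (Card A w)) <->
    exists A, bracket A zero one /\ tr (Card A w)).
  split.
  + intros [e [A [h1 [h2 h]]]]; exists A; split; [|exact h].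
    apply (proj1 (Bracket3_n A e) (conj h1 h2)).
  + intros [A [hA h]]; exists zero, A.
    destruct (proj2 (Bracket3_n A zero) (conj eq_refl hA)); auto.
- apply bracket_ex.
- intros A h; exists zero, zero, one; split; [|auto using eqp_refl].
  intro x; destruct (h x); pose proof (@in_zero x).
  destruct (classic (x ∊ one)); tauto.
Qed.

(** * Parts of disjoint unions and of products *)

Definition is_dsum A B U := forall z,
  (z ∊ U <-> (exists x, x ∊ A /\ z = pr x zero) \/
             (exists x, x ∊ B /\ z = pr x one)) /\
  (mem_neg z U <-> ~ ((exists x, ~ mem_neg x A /\ z = pr x zero) \/
                      (exists x, ~ mem_neg x B /\ z = pr x one))).

Lemma IsSet_dsum A B U : tr (IsSet U (dsum A B)) <-> is_dsum A B U.
Proof.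
assert (h0 : forall z x,
  tr (∃ e, Zero e ∧ Pair z x e)%bs4 <-> z = pr x zero).
{ intros z x.
  change ((exists e, tr (Zero e) /\ tr (Pair z x e)) <-> z = pr x zero).
  split; [intros [e [he h]]; apply Zero_zero in he; subst; apply Pair_pr, h|].
  intro h; exists zero; split; [apply Zero_zero|apply Pair_pr]; trivial. }
assert (h1 : forall z x,
  tr (∃ e, One e ∧ Pair z x e)%bs4 <-> z = pr x one).
{ intros z x; change ((exists e, tr (One e) /\ tr (Pair z x e)) <-> z = pr x one).
  split; [intros [e [he h]]; apply One_one in he; subst; apply Pair_pr, h|].
  intro h; exists one; split; [apply One_one|apply Pair_pr]; trivial. }
assert (hp : forall z, tr (dsum A B z) <->
  (exists x, x ∊ A /\ z = pr x zero) \/ (exists x, x ∊ B /\ z = pr x one)).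
{ intro z; change (tr (dsum A B z)) with
    ((exists x, (tr (∃ e, Zero e ∧ Pair z x e)%bs4 /\ True) /\ x ∊ A) \/
     (exists x, (tr (∃ e, One e ∧ Pair z x e)%bs4 /\ True) /\ x ∊ B)).
  split; (intros [[x h]|[x h]]; [left|right]; exists x; rewrite ?h0, ?h1 in *;
    tauto). }
assert (hn : forall z, fa (dsum A B z) <->
  ~ ((exists x, ~ mem_neg x A /\ z = pr x zero) \/
     (exists x, ~ mem_neg x B /\ z = pr x one))).
{ intro z; change (fa (dsum A B z)) with
    ((forall x, (tr (∃ e, Zero e ∧ Pair z x e)%bs4 -> False) \/ mem_neg x A) /\
     (forall x, (tr (∃ e, One e ∧ Pair z x e)%bs4 -> False) \/ mem_neg x B)).
  split.
  - intros [ha hb] [[x h]|[x h]];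
      [specialize (ha x); rewrite h0 in ha|specialize (hb x); rewrite h1 in hb];
      tauto.
  - intro h; split; intro x; rewrite ?h0, ?h1; apply NNPP; intro h';
      apply h; [left|right]; exists x; split; intros; apply NNPP; tauto. }
unfold is_dsum; change (tr (IsSet U (dsum A B))) with (forall z,
  (z ∊ U <-> tr (dsum A B z)) /\ (mem_neg z U <-> fa (dsum A B z))).
split; intros h z; specialize (h z); specialize (hp z); specialize (hn z);
  rewrite ?hp, ?hn in *; exact h.
Qed.

Definition is_prod A B P := forall z,
  (z ∊ P <-> exists x y, x ∊ A /\ y ∊ B /\ z = pr x y) /\
  (mem_neg z P <->
     ~ exists x y, ~ mem_neg x A /\ ~ mem_neg y B /\ z = pr x y).

Lemma IsSet_prod A B P : tr (IsSet P (prod A B)) <-> is_prod A B P.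
Proof.
assert (hp : forall z, tr (prod A B z) <->
  exists x y, x ∊ A /\ y ∊ B /\ z = pr x y).
{ intro z; change (tr (prod A B z)) with
    (exists x y, (tr (Pair z x y) /\ True) /\ (x ∊ A /\ y ∊ B)).
  split; intros [x [y h]]; exists x, y; rewrite ?Pair_pr in *; tauto. }
assert (hn : forall z, fa (prod A B z) <->
  ~ exists x y, ~ mem_neg x A /\ ~ mem_neg y B /\ z = pr x y).
{ intro z; change (fa (prod A B z)) with
    (forall x y, (tr (Pair z x y) -> False) \/ (mem_neg x A \/ mem_neg y B)).
  split.
  - intros h [x [y h']]; specialize (h x y); rewrite Pair_pr in h; tauto.
  - intros h x y; rewrite Pair_pr; apply NNPP; intro h'; apply h; exists x, y.
    split; [|split]; [| |apply NNPP]; tauto. }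
unfold is_prod; change (tr (IsSet P (prod A B))) with (forall z,
  (z ∊ P <-> tr (prod A B z)) /\ (mem_neg z P <-> fa (prod A B z))).
split; intros h z; specialize (h z); specialize (hp z); specialize (hn z);
  rewrite ?hp, ?hn in *; exact h.
Qed.

Lemma is_dsum_ex A B : exists U, is_dsum A B U.
Proof.
destruct (superset A) as [C [_ hC]], (superset B) as [D [_ hD]].
apply bracket_class_ex with (csum C D); [def|def|].
intros z [[[x [hx ->]]|[x [hx ->]]]|[[x [hx ->]]|[x [hx ->]]]]; apply in_csum;
  [left|right|left|right]; exists x; specialize (hC x); specialize (hD x); tauto.
Qed.

Lemma is_prod_ex A B : exists P, is_prod A B P.
Proof.
destruct (superset A) as [C [_ hC]], (superset B) as [D [_ hD]].
apply bracket_class_ex with (cprod C D); [def|def|].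
intros z [[x [y [hx [hy ->]]]]|[x [y [hx [hy ->]]]]]; apply pr_in_cprod;
  specialize (hC x); specialize (hD y); tauto.
Qed.

Lemma dsum_has_parts A B U T1 B1 N1 T2 B2 N2 :
  has_parts A T1 B1 N1 -> has_parts B T2 B2 N2 -> is_dsum A B U ->
  has_parts U (csum T1 T2) (csum B1 B2) (csum N1 N2).
Proof.
intros [T1' [B1' [N1' [hA [eT1 [eB1 eN1]]]]]]
  [T2' [B2' [N2' [hB [eT2 [eB2 eN2]]]]]] hU.
exists (csum T1' T2'), (csum B1' B2'), (csum N1' N2').
split; [|auto using csum_eqp].
intro z; destruct (hU z) as [hp hn]; rewrite hp, hn, !in_csum.
(* Once the tag of [z] is known, [h] collapses each tagged disjunction to the condition on one
   summand, or to [False] if [z] carries no tag. *)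
destruct (classic (exists x, z = pr x zero)) as [[x ->]|h0];
  [|destruct (classic (exists x, z = pr x one)) as [[x ->]|h1]].
- assert (h : forall C D : M -> Prop, (exists y, C y /\ pr x zero = pr y zero) \/
    (exists y, D y /\ pr x zero = pr y one) <-> C x).
  { intros C D; split; [pairs|intro; left; exists x; auto]. }
  rewrite !h; destruct (hA x) as [-> [-> ->]].
  destruct (classic (mem_neg x A)); tauto.
- assert (h : forall C D : M -> Prop, (exists y, C y /\ pr x one = pr y zero) \/
    (exists y, D y /\ pr x one = pr y one) <-> D x).
  { intros C D; split; [pairs|intro; right; exists x; auto]. }
  rewrite !h; destruct (hB x) as [-> [-> ->]].
  destruct (classic (mem_neg x B)); tauto.
- assert (h : forall C D : M -> Prop, (exists y, C y /\ z = pr y zero) \/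
    (exists y, D y /\ z = pr y one) <-> False).
  { intros C D; split; [|tauto].
    intros [[x hx]|[x hx]]; [apply h0|apply h1]; exists x; tauto. }
  rewrite !h; tauto.
Qed.

(** The common shape of the b-part and the n-part of a product: pairs not lying in [T] and [T'] at
    once, split into three disjoint products. *)
Lemma eqp_mixed T B T' B' C :
  (forall x, x ∊ T -> ~ x ∊ B) -> (forall x, x ∊ T' -> ~ x ∊ B') ->
  (forall z, z ∊ C <-> exists x y, z = pr x y /\
     (x ∊ T /\ y ∊ B' \/ x ∊ B /\ y ∊ T' \/ x ∊ B /\ y ∊ B')) ->
  eqp C (csum (csum (cprod T B') (cprod B T')) (cprod B B')).
Proof.
intros h h' hC; destruct (cup_ex (cprod T B') (cprod B T')) as [D [_ hD]].
apply eqp_trans with (csum D (cprod B B')).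
- apply eqp_split.
  + intro z; rewrite hC, hD, !in_cprod; split.
    * intros [x [y [hz [hxy|[hxy|hxy]]]]];
        [left; left|left; right|right]; exists x, y; tauto.
    * intros [[[x [y hxy]]|[x [y hxy]]]|[x [y hxy]]]; exists x, y; tauto.
  + intros z; rewrite hD, !in_cprod; intros hz [x [y [hx [hy ->]]]]; pairs;
      [eapply h|eapply h']; eassumption.
- apply csum_eqp; [|apply eqp_refl]; apply eqp_split; [exact hD|].
  intro z; rewrite !in_cprod; intros hz [x [y [hx [hy ->]]]]; pairs.
  eapply h; eassumption.
Qed.

(** A pair is true when both components are, and false when one component is. A b-element with an
    n-element thus gives a pair that is false and not true, which lies in no part; this is why the
    b-parts and n-parts never mix. *)
Lemma prod_has_parts A B P T1 B1 N1 T2 B2 N2 :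
  has_parts A T1 B1 N1 -> has_parts B T2 B2 N2 -> is_prod A B P ->
  has_parts P (cprod T1 T2)
    (csum (csum (cprod T1 B2) (cprod B1 T2)) (cprod B1 B2))
    (csum (csum (cprod T1 N2) (cprod N1 T2)) (cprod N1 N2)).
Proof.
intros [T1' [B1' [N1' [hA [eT1 [eB1 eN1]]]]]]
  [T2' [B2' [N2' [hB [eT2 [eB2 eN2]]]]]] hP.
destruct (parts_ex P) as [T [B' [N h]]]; exists T, B', N; split; [exact h|].
assert (hp : forall x y, (pr x y ∊ P <-> x ∊ A /\ y ∊ B) /\
                         (mem_neg (pr x y) P <-> mem_neg x A \/ mem_neg y B)).
{ intros x y; destruct (hP (pr x y)) as [-> ->]; split.
  - split; [pairs; tauto|intros; exists x, y; tauto].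
  - split; [|intros hxy [x' [y' h']]; pairs; tauto].
    intro h'; apply NNPP; intro h''; apply h'; exists x, y; tauto. }
assert (hz : forall z, ~ mem_neg z P \/ z ∊ P -> exists x y, z = pr x y).
{ intros z; destruct (hP z) as [-> ->]; intros [hz|hz]; [apply NNPP in hz|];
    destruct hz as [x [y hz]]; exists x, y; tauto. }
assert (dB : forall x, x ∊ T1' -> ~ x ∊ B1') by (intro x; destruct (hA x); tauto).
assert (dB' : forall x, x ∊ T2' -> ~ x ∊ B2') by (intro x; destruct (hB x); tauto).
assert (dN : forall x, x ∊ T1' -> ~ x ∊ N1') by (intro x; destruct (hA x); tauto).
assert (dN' : forall x, x ∊ T2' -> ~ x ∊ N2') by (intro x; destruct (hB x); tauto).
split; [|split].
- apply eqp_trans with (cprod T1' T2'); [|apply cprod_eqp; assumption].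
  apply eqp_incl; intro z; destruct (h z) as [-> _]; rewrite in_cprod; split.
  + intros [h1 h2]; destruct (hz z) as [x [y ->]]; [tauto|].
    exists x, y; destruct (hA x) as [-> _], (hB y) as [-> _].
    destruct (hp x y); tauto.
  + intros [x [y [hx [hy ->]]]]; destruct (hp x y) as [-> ->].
    apply hA in hx; apply hB in hy; tauto.
- apply eqp_trans with
    (csum (csum (cprod T1' B2') (cprod B1' T2')) (cprod B1' B2'));
    [|auto using csum_eqp, cprod_eqp].
  apply eqp_mixed; trivial; intro z; destruct (h z) as [_ [-> _]]; split.
  + intros [h1 h2]; destruct (hz z) as [x [y ->]]; [tauto|].
    exists x, y; split; [trivial|]; destruct (hA x) as [-> [-> _]].
    destruct (hB y) as [-> [-> _]]; destruct (hp x y) as [h3 h4].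
    apply h3 in h1; apply h4 in h2.
    destruct (classic (mem_neg x A)), (classic (mem_neg y B)); tauto.
  + intros [x [y [-> hxy]]]; destruct (hp x y) as [-> ->].
    destruct (hA x) as [hx [hx' _]], (hB y) as [hy [hy' _]].
    rewrite hx, hx', hy, hy' in hxy; tauto.
- apply eqp_trans with
    (csum (csum (cprod T1' N2') (cprod N1' T2')) (cprod N1' N2'));
    [|auto using csum_eqp, cprod_eqp].
  apply eqp_mixed; trivial; intro z; destruct (h z) as [_ [_ ->]]; split.
  + intros [h1 h2]; destruct (hz z) as [x [y ->]]; [tauto|].
    exists x, y; split; [trivial|]; destruct (hA x) as [-> [_ ->]].
    destruct (hB y) as [-> [_ ->]]; destruct (hp x y) as [h3 h4].
    rewrite h3 in h1; rewrite h4 in h2.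
    destruct (classic (x ∊ A)), (classic (y ∊ B)); tauto.
  + intros [x [y [-> hxy]]]; destruct (hp x y) as [-> ->].
    destruct (hA x) as [hx [_ hx']], (hB y) as [hy [_ hy']].
    rewrite hx, hx', hy, hy' in hxy; tauto.
Qed.

(** Any set of cardinality [k] has the same parts up to equipotence, so sums and products do not
    depend on the representatives chosen in [TAdd] and [TMul]. *)
Lemma rep_Card (s : term M) T B N k A : rep s T B N -> tr (s k) ->
  tr (Card A k) -> has_parts A T B N.
Proof.
intros [_ hs] hk hA; apply hs in hk; destruct (has_parts_ex A) as [T' [B' [N' h]]].
apply (Card_has_parts k h) in hA.
destruct (cardinal_inj hA hk) as [eT [eB eN]].
destruct h as [T'' [B'' [N'' [h [hT [hB hN]]]]]].
exists T'', B'', N''; eauto 10 using eqp_trans.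
Qed.

Lemma rep_value (s : term M) T B N : rep s T B N ->
  exists A k, tr (s k) /\ tr (Card A k).
Proof.
intros [[A hA] hs]; destruct (cardinal_ex T B N) as [k hk]; exists A, k.
split; [apply hs, hk|apply (Card_has_parts k hA), hk].
Qed.

Lemma rep_TAdd (s t : term M) T1 B1 N1 T2 B2 N2 :
  rep s T1 B1 N1 -> rep t T2 B2 N2 ->
  rep (TAdd s t) (csum T1 T2) (csum B1 B2) (csum N1 N2).
Proof.
intros hs ht; apply rep_intro with (fun U => exists A B k m,
  tr (s k) /\ tr (t m) /\ tr (Card A k) /\ tr (Card B m) /\ is_dsum A B U).
- intro w; change (tr (TAdd s t w)) with (exists A B k m U,
    tr (s k) /\ tr (t m) /\ tr (Card A k) /\ tr (Card B m) /\
    tr (IsSet U (dsum A B)) /\ tr (Card U w)); split.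
  + intros [A [B [k [m [U [h1 [h2 [h3 [h4 [h5 h6]]]]]]]]]]; apply IsSet_dsum in h5.
    exists U; split; [exists A, B, k, m; tauto|exact h6].
  + intros [U [[A [B [k [m [h1 [h2 [h3 [h4 h5]]]]]]]] h6]]; apply IsSet_dsum in h5.
    exists A, B, k, m, U; tauto.
- destruct (rep_value hs) as [A [k hA]], (rep_value ht) as [B [m hB]].
  destruct (is_dsum_ex A B) as [U hU]; exists U, A, B, k, m; tauto.
- intros U [A [B [k [m [hk [hm [hA [hB hU]]]]]]]].
  exact (dsum_has_parts (rep_Card hs hk hA) (rep_Card ht hm hB) hU).
Qed.

Lemma rep_TMul (s t : term M) T1 B1 N1 T2 B2 N2 :
  rep s T1 B1 N1 -> rep t T2 B2 N2 ->
  rep (TMul s t) (cprod T1 T2)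
    (csum (csum (cprod T1 B2) (cprod B1 T2)) (cprod B1 B2))
    (csum (csum (cprod T1 N2) (cprod N1 T2)) (cprod N1 N2)).
Proof.
intros hs ht; apply rep_intro with (fun P => exists A B k m,
  tr (s k) /\ tr (t m) /\ tr (Card A k) /\ tr (Card B m) /\ is_prod A B P).
- intro w; change (tr (TMul s t w)) with (exists A B k m P,
    tr (s k) /\ tr (t m) /\ tr (Card A k) /\ tr (Card B m) /\
    tr (IsSet P (prod A B)) /\ tr (Card P w)); split.
  + intros [A [B [k [m [P [h1 [h2 [h3 [h4 [h5 h6]]]]]]]]]]; apply IsSet_prod in h5.
    exists P; split; [exists A, B, k, m; tauto|exact h6].
  + intros [P [[A [B [k [m [h1 [h2 [h3 [h4 h5]]]]]]]] h6]]; apply IsSet_prod in h5.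
    exists A, B, k, m, P; tauto.
- destruct (rep_value hs) as [A [k hA]], (rep_value ht) as [B [m hB]].
  destruct (is_prod_ex A B) as [P hP]; exists P, A, B, k, m; tauto.
- intros P [A [B [k [m [hk [hm [hA [hB hP]]]]]]]].
  exact (prod_has_parts (rep_Card hs hk hA) (rep_Card ht hm hB) hP).
Qed.

(** * Components of a cardinal number and the stated identities *)

Lemma CardinalNumber_rep k :
  tr (CardinalNumber k) -> exists T B N, rep (TVar k) T B N.
Proof.
intros [A hA]; destruct (has_parts_ex A) as [T [B [N h]]]; exists T, B, N.
apply rep_TVar; [exists A; exact h|apply (Card_has_parts k h), hA].
Qed.

Lemma ClassicalCardinal_rep k :
  tr (ClassicalCardinal k) <-> exists T, rep (TVar k) T zero zero.
Proof.
change (tr (ClassicalCardinal k)) with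
  (exists A, tr (Classical A) /\ tr (Card A k)); split.
- intros [A [hA hk]]; apply Classical_cls in hA; exists A.
  pose proof (cls_has_parts hA) as h; apply rep_TVar; [exists A; exact h|].
  apply (Card_has_parts k h), hk.
- intros [T [_ h]]; destruct (sep T (P := fun _ => True)) as [A [hA hAT]]; [def|].
  exists A; split; [apply Classical_cls, hA|].
  apply (Card_has_parts k (cls_has_parts hA)).
  apply cardinal_ext with T zero zero; [|apply eqp_refl|apply eqp_refl|].
  + apply eqp_incl; intro x; rewrite hAT; tauto.
  + apply h; reflexivity.
Qed.

Lemma classical_cardinal_ex T : exists k, rep (TVar k) T zero zero.
Proof.
destruct (sep T (P := fun _ => True)) as [A [hA hAT]]; [def|].
destruct (cardinal_ex T zero zero) as [k hk]; exists k; apply rep_TVar; trivial.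
exists A; destruct (cls_has_parts hA) as [T' [B' [N' [h [hT [hB hN]]]]]].
exists T', B', N'; split; [exact h|split; [|tauto]].
apply eqp_trans with A; [exact hT|]; apply eqp_incl; intro x; rewrite hAT; tauto.
Qed.

Lemma rep_ext (s : term M) T B N T' B' N' :
  eqp T T' -> eqp B B' -> eqp N N' -> rep s T B N -> rep s T' B' N'.
Proof.
intros eT eB eN [[A [T0 [B0 [N0 [h [hT [hB hN]]]]]]] hs]; split.
- exists A, T0, B0, N0; eauto 10 using eqp_trans.
- intro w; rewrite hs; split; apply cardinal_ext; trivial; apply eqp_sym; trivial.
Qed.

Ltac reps := repeat lazymatch goal with
  | |- rep (TAdd _ _) _ _ _ => apply rep_TAdd
  | |- rep (TMul _ _) _ _ _ => apply rep_TMul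
  | |- rep T0 _ _ _ => apply rep_T0
  | |- rep T1 _ _ _ => apply rep_T1
  | |- rep Tb _ _ _ => apply rep_Tb
  | |- rep Tn _ _ _ => apply rep_Tn
  | |- rep ?s _ _ _ =>
      match goal with h : rep ?s' _ _ _ |- _ => constr_eq s s'; exact h end
  end.

(** Contains both existence and uniqueness of the decomposition: for classical cardinals,
    multiplying by [Tb] or [Tn] moves the single component into the b- or n-place, so the right-hand
    side has exactly the three given cardinals as components. *)
Lemma Decomposition_rep k t b n T B N : rep (TVar k) T B N ->
  tr (Decomposition k t b n) <->
  rep (TVar t) T zero zero /\ rep (TVar b) B zero zero /\
  rep (TVar n) N zero zero.
Proof.
intro hk; change (tr (Decomposition k t b n)) with
  (tr (ClassicalCardinal t) /\ tr (ClassicalCardinal b) /\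
   tr (ClassicalCardinal n) /\
   tr (TEq (TVar k) (TVar t + TVar b * Tb + TVar n * Tn)%card)).
rewrite !ClassicalCardinal_rep; split.
- intros [[T' ht] [[B' hb] [[N' hn] h]]].
  eapply TEq_rep in h; [|exact hk|reps]; destruct h as [eT [eB eN]].
  split; [|split]; (eapply rep_ext; [|apply eqp_refl|apply eqp_refl|eassumption]);
    apply eqp_sym; eapply eqp_trans; try eassumption; ring.
- intros [ht [hb hn]]; split; [|split; [|split]]; [eauto|eauto|eauto|].
  eapply TEq_rep; [exact hk|reps|]; split; [|split]; ring.
Qed.

(** Shows that the descriptions [Pt k], [Pb k] and [Pn k] denote, so that they can occur in the
    identities like any other term. *)
Lemma rep_parts k T B N : rep (TVar k) T B N ->
  rep (Pt k) T zero zero /\ rep (Pb k) B zero zero /\ rep (Pn k) N zero zero.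
Proof.
intro hk.
destruct (classical_cardinal_ex T) as [t ht], (classical_cardinal_ex B) as [b hb].
destruct (classical_cardinal_ex N) as [n hn].
assert (h : forall (s : term M) S,
  (forall v, tr (s v) <-> rep (TVar v) S zero zero) ->
  (exists k, rep (TVar k) S zero zero) -> rep s S zero zero).
{ intros s S hs [v [h hv]]; split; [exact h|]; intro w; rewrite hs; split.
  - intros [_ hw]; apply hw; reflexivity.
  - intro hw; exact (rep_TVar h hw). }
split; [|split]; apply h; eauto; intro v.
- change (tr (Pt k v)) with (exists b n, tr (Decomposition k v b n)).
  split; [intros [b' [n' hd]]; apply (Decomposition_rep v b' n' hk) in hd; tauto|].
  intro hv; exists b, n; apply (Decomposition_rep v b n hk); tauto.
- change (tr (Pb k v)) with (exists t n, tr (Decomposition k t v n)).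
  split; [intros [t' [n' hd]]; apply (Decomposition_rep t' v n' hk) in hd; tauto|].
  intro hv; exists t, n; apply (Decomposition_rep t v n hk); tauto.
- change (tr (Pn k v)) with (exists t b, tr (Decomposition k t b v)).
  split; [intros [t' [b' hd]]; apply (Decomposition_rep t' b' v hk) in hd; tauto|].
  intro hv; exists t, b; apply (Decomposition_rep t b v hk); tauto.
Qed.

Lemma TEq_ring (s s' : term M) T B N T' B' N' :
  rep s T B N -> rep s' T' B' N' ->
  eqp T T' -> eqp B B' -> eqp N N' -> tr (TEq s s').
Proof. intros hs hs' hT hB hN; apply (TEq_rep hs hs'); auto. Qed.

(** [reps] computes the components of both sides, leaving three commutative semiring identities up
    to [eqp]. *)
Ltac cardinal_arithmetic :=
  eapply TEq_ring; [solve [reps]|solve [reps]| | |]; ring.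

Lemma sum_decomposition (k m : M) :
  tr (CardinalNumber k) -> tr (CardinalNumber m) ->
  tr (TVar k + TVar m ≡
      (Pt k + Pt m) + (Pb k + Pb m) * Tb + (Pn k + Pn m) * Tn)%bs4.
Proof.
intros hk hm; destruct (CardinalNumber_rep hk) as [T [B [N rk]]].
destruct (CardinalNumber_rep hm) as [T' [B' [N' rm]]].
destruct (rep_parts rk) as [rkt [rkb rkn]], (rep_parts rm) as [rmt [rmb rmn]].
cardinal_arithmetic.
Qed.

Lemma product_decomposition (k m : M) :
  tr (CardinalNumber k) -> tr (CardinalNumber m) ->
  tr (TVar k * TVar m ≡
      Pt k * Pt m
        + (Pt k * Pb m + Pb k * Pt m + Pb k * Pb m) * Tb
        + (Pt k * Pn m + Pn k * Pt m + Pn k * Pn m) * Tn)%bs4.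
Proof.
intros hk hm; destruct (CardinalNumber_rep hk) as [T [B [N rk]]].
destruct (CardinalNumber_rep hm) as [T' [B' [N' rm]]].
destruct (rep_parts rk) as [rkt [rkb rkn]], (rep_parts rm) as [rmt [rmb rmn]].
cardinal_arithmetic.
Qed.

Lemma product_one (k : M) :
  tr (CardinalNumber k) -> tr (TVar k * T1 ≡ TVar k)%bs4.
Proof.
intro hk; destruct (CardinalNumber_rep hk) as [T [B [N rk]]]; cardinal_arithmetic.
Qed.

Lemma product_zero (k : M) :
  tr (CardinalNumber k) -> tr (TVar k * T0 ≡ T0)%bs4.
Proof.
intro hk; destruct (CardinalNumber_rep hk) as [T [B [N rk]]]; cardinal_arithmetic.
Qed.

Lemma square_b : tr (@Tb M * Tb ≡ Tb)%bs4.
Proof. cardinal_arithmetic. Qed.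

Lemma square_n : tr (@Tn M * Tn ≡ Tn)%bs4.
Proof. cardinal_arithmetic. Qed.

Lemma product_b_n : tr (@Tb M * Tn ≡ T0)%bs4.
Proof. cardinal_arithmetic. Qed.

End Classical.

Theorem theorem5p11 :
  BZFC ⊨ (fun M =>
    (∀ k m : M, CardinalNumber k ∧ CardinalNumber m →
       (TVar k + TVar m ≡
          (Pt k + Pt m) + (Pb k + Pb m) * Tb + (Pn k + Pn m) * Tn)
       ∧
       (TVar k * TVar m ≡
          Pt k * Pt m
            + (Pt k * Pb m + Pb k * Pt m + Pb k * Pb m) * Tb
            + (Pt k * Pn m + Pn k * Pt m + Pn k * Pn m) * Tn))
    ∧ (∀ k : M, CardinalNumber k →
         (TVar k * T1 ≡ TVar k) ∧ (TVar k * T0 ≡ T0))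
    ∧ (@Tb M * Tb ≡ Tb) ∧ (@Tn M * Tn ≡ Tn) ∧ (@Tb M * Tn ≡ T0))%bs4.
Proof.
intros M hM; split; [|split; [|split; [|split]]].
- intros k m [hk hm]; split.
  + exact (sum_decomposition hM hk hm).
  + exact (product_decomposition hM hk hm).
- intros k hk; split.
  + exact (product_one hM hk).
  + exact (product_zero hM hk).
- exact (square_b hM).
- exact (square_n hM).
- exact (product_b_n hM).
Qed.
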